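(* Consider the two conditions $$\text{(D)}\quad \theta_{\min}\in\Theta_2\ \text{ and }\ G'(\theta_{\min})>-\infty,\qquad\qquad \text{(C)}\quad k>k_{\mathrm{cr}}:=-G(\theta_{\min})+\theta_{\min}G'(\theta_{\min}),$$ where $G'(\theta_{\min})$ denotes the right derivative (and (C) is considered only when (D) holds). (i) If for some $k\in(0,k_{\max})$ the worst case localiser $\hat q_k$ is a density, then it is a worst case density for $k$ unless both (D) and (C) hold. If (D) and (C) hold, then $\hat q_k=\hat q_{k_{\mathrm{cr}}}=q_{\theta_{\min}}$ and no worst case density exists for $k$. (ii) If $\mathrm{dom}\,K$ contains the $\theta_1$-axis, i.e. $\int\beta^*(r,\theta_1)\,\mu(dr)$ is finite for each $\theta_1\in\mathbb{R}$, then for each $k\in(0,k_{\max})$ the worst case localiser $\hat q_k$ is a density, and hence it is a worst case density for $k$ unless both (D) and (C) hold.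
   Context: Setup. $\Omega$ is a set with a $\sigma$-algebra and a finite or $\sigma$-finite measure $\mu$; functions on $\Omega$ are measurable and equality of functions is meant $\mu$-a.e. The function $\beta:\Omega\times\mathbb{R}\to(-\infty,+\infty]$ is measurable in $r$ for each $s$; for each $r$, $\beta(r,\cdot)$ is finite, strictly convex and differentiable on $(0,+\infty)$, $\beta(r,0)=\lim_{s\downarrow0}\beta(r,s)$, and $\beta(r,s)=+\infty$ for $s<0$. Put $H(p):=\int_\Omega\beta(r,p(r))\,\mu(dr)$ for $p\ge0$. A density is a nonnegative function $p$ with $\int p\,d\mu=1$. $X:\Omega\to\mathbb{R}$ is measurable, $m$ and $M$ are its $\mu$-essential infimum and supremum, and $p_0$ is a density (the default density) for which $b_0:=\int Xp_0\,d\mu$ exists. Standing assumptions: $-\infty\le m<b_0<M\le+\infty$; $H(p)\ge H(p_0)=0$ for every density $p$; and $k_{\max}:=\lim_{b\downarrow m}F(b)>0$, where $$F(b):=\inf\Big\{H(p):\ p\ge 0,\ \int p\,d\mu=1,\ \int Xp\,d\mu=b\Big\}.$$ Also $$V(k):=\inf\Big\{\int Xp\,d\mu:\ p\ge 0,\ \int p\,d\mu=1,\ H(p)\le k\Big\}.$$ A worst case density for $k$ is a density $p$ with $H(p)\le k$ and $\int Xp\,d\mu=V(k)$. Conventions: $\inf\emptyset=+\infty$; the integrals defining $H$ and $K$ are set to $+\infty$ when not well defined. Conjugates. $\beta^*(r,\tau):=\sup_{s\in\mathbb{R}}(s\tau-\beta(r,s))$; primes on $\beta,\beta^*$ denote derivatives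 in the second variable, and $\beta'(r,0),\beta'(r,+\infty)$ are limits of $\beta'(r,s)$ as $s\downarrow0$, $s\uparrow+\infty$. Put $$K(\theta_1,\theta_2):=\int\beta^*(r,\theta_1+\theta_2X(r))\,\mu(dr),\qquad G(\theta_2):=\inf_{\theta_1\in\mathbb{R}}[K(\theta_1,\theta_2)-\theta_1],$$ $\mathrm{dom}\,K:=\{K<+\infty\}$, $\Theta_2$ is the projection of $\mathrm{dom}\,K$ to the $\theta_2$-axis (an interval containing $0$), and $\theta_{\min}\in[-\infty,0)$ is the left endpoint of $\Theta_2$ (negative by the standing assumptions). Put $\Theta:=\{(\theta_1,\theta_2)\in\mathrm{dom}\,K:\ \theta_1+\theta_2X(r)<\beta'(r,+\infty)\ \mu\text{-a.e.}\}$, and for $(\theta_1,\theta_2)\in\Theta$, $p_{\theta_1,\theta_2}(r):=(\beta^* )'(r,\theta_1+\theta_2X(r))$. For each $\theta_2\in\Theta_2$ the infimum defining $G(\theta_2)$ is attained by a unique $\theta_1$, with $(\theta_1,\theta_2)\in\Theta$; with this $\theta_1$ put $q_{\theta_2}:=p_{\theta_1,\theta_2}$. Worst case localiser. For $k\in(0,k_{\max})$ the maximum of $\frac{k+K(\theta_1,\theta_2)-\theta_1}{\theta_2}$ over $\theta_1\in\mathbb{R},\ \theta_2<0$ is attained, every maximiser lies in $\Theta$, and $\hat q_k:=p_{\theta_1,\theta_2}=q_{\theta_2}$ with $(\theta_1,\theta_2)$ a maximiser; as a function it does not depend on the choice of the maximiser. (If $k_{\mathrm{cr}}=0$, $\hat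 q_{k_{\mathrm{cr}}}$ is understood by the same formula with $k=0$.) *)

(* Defs.v *)
From HB Require Import structures.
From mathcomp Require Import all_boot all_order all_algebra.
From mathcomp Require Import all_classical all_reals all_analysis.
From mathcomp Require Import measurable_realfun ess_sup_inf.

Set Implicit Arguments.
Unset Strict Implicit.
Unset Printing Implicit Defensive.

Import Order.TTheory GRing.Theory Num.Theory.
Import numFieldNormedType.Exports.

Local Open Scope classical_set_scope.
Local Open Scope ring_scope.
Local Open Scope ereal_scope.

Section real_analysis.
Context {R : realType}.

Definition strictly_convex_on (D : set R) (f : R -> R) : Prop :=
  forall x y t : R, D x -> D y -> x <> y -> (0 < t < 1)%R ->
    (f (t * x + (1 - t) * y) < t * f x + (1 - t) * f y)%R.

(* Filter of the one-sided limit "b decreases to a" for real b, where a may be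
   -oo; the value at +oo plays no role. *)
Definition decreasing_to (a : \bar R) : set_system R :=
  match a with
  | r%:E => at_right r
  | -oo => ninfty_nbhs R
  | +oo => pinfty_nbhs R
  end.

Definition right_derivative (f : R -> \bar R) (x : R) : \bar R :=
  lim ((f (x + h)%R - f x) * (h^-1)%:E @[h --> (0 : R)^'+]).

End real_analysis.

Section integrals.
Context d (T : measurableType d) (R : realType).
Variable mu : {measure set T -> \bar R}.

Definition integral_defined (f : T -> \bar R) : Prop :=
  (\int[mu]_r (f ^\+) r < +oo) \/ (\int[mu]_r (f ^\-) r < +oo).

(* The library evaluates +oo - +oo to -oo, so the convention that an undefined
   integral is +oo has to be imposed explicitly. *)
Definition integral_or_pinfty (f : T -> \bar R) : \bar R :=
  if `[< integral_defined f >] then \int[mu]_r f r else +oo.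

Definition has_integral (f : T -> \bar R) (v : \bar R) : Prop :=
  integral_defined f /\ \int[mu]_r f r = v.

(* Functions are identified when equal mu-a.e., so nonnegativity everywhere is
   no restriction. *)
Definition is_density (p : T -> R) : Prop :=
  [/\ measurable_fun [set: T] p, (forall r, (0 <= p r)%R) &
      \int[mu]_r (p r)%:E = 1].

End integrals.

Section integrand.
Context d (T : measurableType d) (R : realType).
Variable beta : T -> R -> \bar R.

Record convex_integrand : Prop := ConvexIntegrand {
  integrand_measurable :
    forall s : R, measurable_fun [set: T] (fun r => beta r s) ;
  integrand_gtNy : forall r s, -oo < beta r s ;
  integrand_fin : forall r s, (0 < s)%R -> beta r s \is a fin_num ;
  integrand_strictly_convex : forall r,
    strictly_convex_on [set s : R | (0 < s)%R] (fun s => fine (beta r s)) ;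
  integrand_derivable : forall r (s : R), (0 < s)%R ->
    derivable (fun s => fine (beta r s)) s 1%R ;
  integrand_at0 : forall r, beta r s @[s --> (0 : R)^'+] --> beta r 0%R ;
  integrand_neg : forall r s, (s < 0)%R -> beta r s = +oo
}.

Definition conjugate (r : T) (tau : R) : \bar R :=
  ereal_sup [set (s * tau)%:E - beta r s | s in [set: R]].

Definition dbeta (r : T) (s : R) : R := derive1 (fun s => fine (beta r s)) s.

Definition dbeta_pinfty (r : T) : \bar R :=
  lim ((dbeta r s)%:E @[s --> +oo%R]).

(* Meaningful for tau < dbeta_pinfty r, where the conjugate is finite. *)
Definition dconjugate (r : T) (tau : R) : R :=
  derive1 (fun tau => fine (conjugate r tau)) tau.

End integrand.

Section worst_case.
Context d (T : measurableType d) (R : realType).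
Variables (mu : {measure set T -> \bar R}) (beta : T -> R -> \bar R).
Variable X : T -> R.

Definition H (p : T -> R) : \bar R :=
  integral_or_pinfty mu (fun r => beta r (p r)).

Definition F (b : R) : \bar R :=
  ereal_inf [set H p | p in [set p : T -> R | is_density mu p /\
    has_integral mu (fun r => (X r * p r)%:E) b%:E]].

Definition k_max : \bar R :=
  lim (F b @[b --> decreasing_to (ess_inf mu (EFin \o X))]).

Definition V (k : R) : \bar R :=
  ereal_inf [set v : \bar R | exists p : T -> R,
    [/\ is_density mu p, H p <= k%:E &
        has_integral mu (fun r => (X r * p r)%:E) v]].

Definition worst_case_density (k : R) (p : T -> R) : Prop :=
  [/\ is_density mu p, H p <= k%:E &
      has_integral mu (fun r => (X r * p r)%:E) (V k)].

Definition K (t1 t2 : R) : \bar R :=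
  integral_or_pinfty mu (fun r => conjugate beta r (t1 + t2 * X r)%R).

Definition G (t2 : R) : \bar R :=
  ereal_inf [set K t1 t2 - t1%:E | t1 in [set: R]].

Definition dom_K : set (R * R) := [set t | K t.1 t.2 < +oo].

Definition Theta2 : set R := [set t.2 | t in dom_K].

Definition theta_min : \bar R := ereal_inf [set t%:E | t in Theta2].

(* For (t1, t2) in the set Theta of the parameters with K t1 t2 < +oo and
   t1 + t2 * X r < dbeta_pinfty beta r for a.e. r, the second branch only
   concerns a null set; 0 keeps the function measurable and nonnegative. *)
Definition p_theta (t1 t2 : R) (r : T) : R :=
  if (t1 + t2 * X r)%:E < dbeta_pinfty beta r
  then dconjugate beta r (t1 + t2 * X r)%R else 0%R.

Definition q_theta (t2 : R) : T -> R :=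
  p_theta (xget 0%R [set t1 | K t1 t2 - t1%:E = G t2]) t2.

(* Since t.2 < 0, the value is -oo outside dom_K. *)
Definition dual_value (k : R) (t : R * R) : \bar R :=
  (k%:E + K t.1 t.2 - t.1%:E) * (t.2^-1)%:E.

Definition dual_maximisers (k : R) : set (R * R) :=
  [set t | (t.2 < 0)%R /\
    forall u : R * R, (u.2 < 0)%R -> dual_value k u <= dual_value k t].

(* The maximiser need not be unique, but p_theta is a.e. the same function for
   all of them. *)
Definition localiser (k : R) : T -> R :=
  let t := xget (0, 0)%R (dual_maximisers k) in p_theta t.1 t.2.

Definition condition_D : Prop :=
  [/\ theta_min \is a fin_num, Theta2 (fine theta_min) &
      -oo < right_derivative G (fine theta_min)].

(* k_cr and condition_C are meaningful only under condition_D. *)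
Definition k_cr : \bar R :=
  - G (fine theta_min) + theta_min * right_derivative G (fine theta_min).

Definition condition_C (k : R) : Prop := k_cr < k%:E.

End worst_case.

(* Main.v *)
(** Everything rests on convex duality between densities [p] and multipliers
    [(theta1, theta2)], done with one-dimensional tools only.

    A constraint of the primal problem is removed by a multiplier that exists by
    order completeness of the reals; the energy constraint [H p <= k] is treated
    first, the mass constraint [int p = 1] second.  What remains is an inequality
    [int (theta1 + theta2 X) p - beta(p) <= A] for all [p], and switching [p]
    repeatedly to profitable rational constants on sets of finite measure turns it
    into [K theta1 theta2 <= A].  Applied at the primal value [V k] this gives at
    once strong duality and the attainment of the dual maximum.

    At a maximiser, [K] dominates an affine function with contact; by monotone
    convergence of difference quotients the directional derivatives of [K] are the
    integrals of [q * direction], where [q] is the localiser.  Comparing slopes gives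
    [int q <= 1], [int X q >= V k], and equality in the latter unless the maximiser
    sits at [theta_min] with [G'(theta_min) > V k], which is (D) and (C).  In that
    case a worst case density would attain equality in Young's inequality, hence
    equal [q], and the derivative of [K] along [q] would force
    [V k >= G'(theta_min)]. *)

(* The obstacle is that [K] may jump to [+oo] at the edge of its domain, so a maximiser need not be
   stationary and the equations [int q = 1], [int X q = V k] cannot be read off. Two moves always
   stay in the domain: decreasing theta1, because conjugates increase, and going towards a domain
   point on the axis theta2 = 0. The first yields only [int q <= 1]. Equality needs moves that
   increase theta1, which is why part (i) assumes a density and part (ii) assumes the whole
   theta1-axis.

   Under (D), [G] has at theta_min a half-line of supporting slopes ending at [G'(theta_min)]. Level
   [k_cr] corresponds to that last slope, and a level [k] above it to the smaller slope [V k]. All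
   these levels share their maximiser, so the localiser stays the same while [V k] goes on
   decreasing. *)
Require Import Defs.
From HB Require Import structures.
From mathcomp Require Import all_boot all_order all_algebra.
From mathcomp Require Import all_classical all_reals all_analysis.
From mathcomp Require Import measurable_realfun ess_sup_inf.
From mathcomp Require Import ring lra.

Import Order.TTheory GRing.Theory Num.Theory.
Import numFieldNormedType.Exports.

Local Open Scope classical_set_scope.
Local Open Scope ring_scope.

Set Implicit Arguments.
Unset Strict Implicit.

(** * The integrand at a fixed point *)

Section convex_integrand_pointwise.
Context d (T : measurableType d) (R : realType) (beta : T -> R -> \bar R).
Hypothesis hbeta : convex_integrand beta.
Variable r : T.

Let f s : R := fine (beta r s).

Let betaE (s : R) : 0 < s -> beta r s = (f s)%:E.
Proof. by move=> s0; rewrite /f fineK// (integrand_fin hbeta). Qed.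

Lemma dbeta_cvg (x : R) : 0 < x ->
  h^-1 * (f (x + h) - f x) @[h --> (0 : R)^'] --> dbeta beta r x.
Proof.
move=> x0; have := integrand_derivable hbeta (r := r) x0.
rewrite /derivable /dbeta derive1E /derive => /cvg_ex[l /= hl].
rewrite (cvg_lim _ hl)//; apply: cvg_trans hl.
apply: near_eq_cvg; near=> h; rewrite /f/= /GRing.scale/= mulr1.
by rewrite [h + x]addrC.
Unshelve. all: by end_near. Qed.

Lemma tangent_pos (x y : R) : 0 < x -> 0 < y ->
  f x + dbeta beta r x * (y - x) <= f y.
Proof.
move=> x0 y0; have [->|yx] := eqVneq y x; first by rewrite subrr mulr0 addr0.
have yx0 : (y - x != 0) by rewrite subr_eq0.
rewrite addrC -lerBrDr.
(* The increment [t * (y - x)] tends to 0 without vanishing, whatever its sign, so the two-sided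
   derivative covers [y < x] and [y > x] at once. *)
have ht : t * (y - x) @[t --> (0 : R)^'+] --> (0 : R)^'.
  move=> A /= [e/= e0 he].
  exists (e / `|y - x|) => /=; first by rewrite divr_gt0// normr_gt0.
  move=> t /=; rewrite sub0r normrN => te t0; apply: he => /=.
    by rewrite sub0r normrN normrM -ltr_pdivlMr ?normr_gt0.
  by rewrite mulf_neq0// gt_eqF.
have hc : (t * (y - x))^-1 * (f (x + t * (y - x)) - f x)
    @[t --> (0 : R)^'+] --> dbeta beta r x.
  exact: (cvg_comp _ _ ht (dbeta_cvg x0)).
have hc2 : (t * (y - x))^-1 * (f (x + t * (y - x)) - f x) * (y - x)
    @[t --> (0 : R)^'+] --> dbeta beta r x * (y - x).
  by apply: cvgM => //; apply: cvg_cst.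
rewrite -(cvg_lim _ hc2)//; apply: limr_le; first by apply/cvg_ex; eexists; exact: hc2.
near=> t.
have t0 : (0 < t) by near: t; exact: nbhs_right_gt.
have t1 : (t < 1) by near: t; apply: nbhs_right_lt.
have := @integrand_strictly_convex _ _ _ _ hbeta r y x t y0 x0 (elimN eqP yx).
rewrite t0 t1 => /(_ isT); rewrite -!/(f _).
have -> : (t * y + (1 - t) * x = x + t * (y - x)) by ring.
move=> hs.
have -> : ((t * (y - x))^-1 * (f (x + t * (y - x)) - f x) * (y - x) =
  t^-1 * (f (x + t * (y - x)) - f x)).
  by field; rewrite yx0 gt_eqF.
rewrite mulrC ler_pdivrMr//; lra.
Unshelve. all: by end_near. Qed.

Lemma tangent_pos_lt (x y : R) : 0 < x -> 0 < y -> x <> y ->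
  f x + dbeta beta r x * (y - x) < f y.
Proof.
move=> x0 y0 xy.
have t01 : 0 < (2^-1 : R) < 1 by apply/andP; split; lra.
have := @integrand_strictly_convex _ _ _ _ hbeta r x y _ x0 y0 xy t01.
have z0 : (0 < 2^-1 * x + (1 - 2^-1) * y) by lra.
have := tangent_pos x0 z0.
rewrite -!/(f _).
set z := (f (_ + _)); set D := dbeta _ _ _ => h1 h2.
have : (D * (2^-1 * x + (1 - 2^-1) * y - x) = 2^-1 * (D * (y - x))) by field.
move: h1 => /[swap] ->; lra.
Qed.

Lemma dbeta_increasing (x y : R) : 0 < x -> (x < y) ->
  dbeta beta r x < dbeta beta r y.
Proof.
move=> x0 xy; have y0 : (0 < y) by lra.
have h1 := tangent_pos_lt x0 y0 ltac:(lra).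
have h2 := tangent_pos_lt y0 x0 ltac:(lra).
by rewrite -(ltr_pM2r (_ : 0 < y - x)); lra.
Qed.

Lemma beta_cvg_right (s : R) : (0 <= s) -> beta r x @[x --> s^'+] --> beta r s.
Proof.
rewrite le_eqVlt => /predU1P[<-|s0]; first exact: (integrand_at0 hbeta).
have fs : f x @[x --> s^'+] --> f s.
  apply: cvg_at_right_filter; apply: differentiable_continuous.
  by apply/derivable1_diffP; apply: (integrand_derivable hbeta).
rewrite betaE//; apply: cvg_EFin => //; near=> x.
by apply: (integrand_fin hbeta); apply: lt_trans s0 _; near: x; apply: nbhs_right_gt.
Unshelve. all: by end_near. Qed.

Lemma beta_cvg_pos (s : R) : 0 < s -> beta r x @[x --> s] --> beta r s.
Proof.
move=> s0; rewrite betaE//; apply: cvg_EFin.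
  near=> x; apply: (integrand_fin hbeta); near: x; exact: lt_nbhsr.
apply: differentiable_continuous.
by apply/derivable1_diffP; apply: (integrand_derivable hbeta).
Unshelve. all: by end_near. Qed.

Lemma affine_cvg (A tau s : R) : (A + tau * x)%:E @[x --> s] --> (A + tau * s)%:E.
Proof.
apply: cvg_EFin; first exact: nearW.
by apply: cvgD; [exact: cvg_cst|apply: cvgM; [exact: cvg_cst|exact: cvg_id]].
Qed.

(** Affine bounds pass from positive points to their limit [s]. At [s = 0] only the right limit is
    available and [beta r 0] may be [+oo], hence the extended-real form. *)
Lemma beta_le_right (s A tau : R) : 0 <= s ->
  (\forall x \near s^'+, (beta r x <= (A + tau * x)%:E)%E) ->
  (beta r s <= (A + tau * s)%:E)%E.
Proof.
move=> s0 h; apply: lee_cvg_to h; first exact: beta_cvg_right.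
exact/cvg_at_right_filter/affine_cvg.
Qed.

Lemma beta_ge_right (s A tau : R) : 0 <= s ->
  (\forall x \near s^'+, ((A + tau * x)%:E <= beta r x)%E) ->
  ((A + tau * s)%:E <= beta r s)%E.
Proof.
move=> s0 h; apply: lee_cvg_to h; last exact: beta_cvg_right.
exact/cvg_at_right_filter/affine_cvg.
Qed.

Lemma beta_le_left (s A tau : R) : 0 < s ->
  (\forall x \near s^'-, (beta r x <= (A + tau * x)%:E)%E) ->
  (beta r s <= (A + tau * s)%:E)%E.
Proof.
move=> s0 h; apply: lee_cvg_to h; apply: cvg_at_left_filter.
  exact: beta_cvg_pos.
exact: affine_cvg.
Qed.

Lemma tangent_le (x y : R) : 0 < x ->
  ((f x + dbeta beta r x * (y - x))%:E <= beta r y)%E.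
Proof.
move=> x0; have [y0|y0|<-] := ltgtP 0 y.
- by rewrite betaE// lee_fin tangent_pos.
- by rewrite (integrand_neg hbeta)// leey.
- have -> : f x + dbeta beta r x * (0 - x) =
      (f x - dbeta beta r x * x) + dbeta beta r x * 0 by ring.
  apply: beta_ge_right => //; near=> s.
  have s0 : 0 < s by near: s; exact: nbhs_right_gt.
  rewrite betaE// lee_fin; apply: le_trans (tangent_pos x0 s0); lra.
Unshelve. all: by end_near. Qed.

(** The tangent at a positive mixture bounds both values from below, and its slope terms average to
    zero. A mixture equal to 0 has no tangent and is settled by cases on the vanishing factors. *)
Lemma beta_convex (s s' A B t : R) : 0 <= s -> 0 <= s' -> 0 <= t <= 1 ->
  (beta r s <= A%:E)%E -> (beta r s' <= B%:E)%E ->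
  (beta r (t * s + (1 - t) * s') <= (t * A + (1 - t) * B)%:E)%E.
Proof.
move=> s0 s'0 /andP[t0 t1] hA hB; set z := t * s + _.
have u0 : 0 <= 1 - t by lra.
have : 0 <= z by rewrite addr_ge0// mulr_ge0.
rewrite le_eqVlt => /predU1P[zE|z0]; last first.
  rewrite betaE// lee_fin.
  have := le_trans (tangent_le s z0) hA; have := le_trans (tangent_le s' z0) hB.
  rewrite !lee_fin => h1 h2.
  have := lerD (ler_wpM2l t0 h2) (ler_wpM2l u0 h1).
  set D := dbeta _ _ _.
  suff -> : t * (f z + D * (s - z)) + (1 - t) * (f z + D * (s' - z)) = f z by [].
  by rewrite /z; ring.
have /eqP := esym zE; rewrite paddr_eq0 ?mulr_ge0// !mulf_eq0.
rewrite -zE => /andP[/orP[/eqP te|/eqP se] /orP[/eqP ue|/eqP s'e]].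
- by exfalso; lra.
- by rewrite te mul0r add0r subr0 mul1r -s'e.
- by have -> : t = 1 by [lra]; rewrite mul1r subrr mul0r addr0 -se.
- rewrite -se; case: (lerP A B) => AB.
    apply: (@le_trans _ _ A%:E); first exact: hA.
    by rewrite lee_fin; nra.
  apply: (@le_trans _ _ B%:E); first by rewrite se -s'e.
  by rewrite lee_fin; nra.
Qed.

(* The generalized inverse of [dbeta beta r], that is the derivative of the conjugate
   where it exists; it is [+oo] from [dbeta_pinfty beta r] on. *)
Definition conjugate_slope (tau : R) : \bar R :=
  ereal_sup [set s%:E | s in [set s | s = 0 \/ 0 < s /\ dbeta beta r s < tau]].

Local Notation S := conjugate_slope.

Lemma conjugate_slope_ge0 tau : (0 <= S tau)%E.
Proof. by apply: ereal_sup_ubound; exists 0 => //; left. Qed.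

Lemma conjugate_slope_ge tau (s : R) : 0 < s -> dbeta beta r s < tau -> (s%:E <= S tau)%E.
Proof. by move=> s0 h; apply: ereal_sup_ubound; exists s => //; right. Qed.

Lemma conjugate_slope_gt tau (s : R) : 0 < s -> (s%:E < S tau)%E -> dbeta beta r s < tau.
Proof.
move=> s0 /ereal_sup_gt[_ [s' /= hs' <-]]; rewrite lte_fin => ss'.
case: hs' => [s'0|[s'0 h]]; first by lra.
by apply: lt_trans (dbeta_increasing s0 ss') h.
Qed.

Lemma conjugate_slope_homo tau tau' : tau <= tau' -> (S tau <= S tau')%E.
Proof.
move=> tt; apply: le_ereal_sup => _ [s /= hs <-]; exists s => //=.
by case: hs => [->|[s0 h]]; [left|right; split => //; apply: lt_le_trans tt].
Qed.

Lemma conjugate_slope_finP tau : (S tau < +oo)%E -> exists2 s, 0 <= s & S tau = s%:E.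
Proof.
have := conjugate_slope_ge0 tau.
by case: (S tau) => // s; rewrite lee_fin; exists s.
Qed.

Lemma conjugate_slope_fin tau (s : R) : 0 < s -> tau <= dbeta beta r s -> (S tau <= s%:E)%E.
Proof.
move=> s0 h; rewrite leNgt; apply/negP => /conjugate_slope_gt => /(_ s0).
by rewrite ltNge h.
Qed.

Lemma conjugate_leP tau A : (conjugate beta r tau <= A%:E)%E <->
  forall s, 0 <= s -> ((s * tau - A)%:E <= beta r s)%E.
Proof.
split=> [h s s0|h].
  have : ((s * tau)%:E - beta r s <= A%:E)%E.
    by apply: le_trans h; apply: ereal_sup_ubound; exists s.
  have := integrand_gtNy hbeta r s.
  case: (beta r s) => // [b _|_ _]; last by rewrite leey.
  rewrite -EFinB !lee_fin; lra.
apply: ge_ereal_sup => _ [s _ <-].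
have [s0|s0] := leP 0 s; last by rewrite (integrand_neg hbeta)//= leNye.
have := h s s0; have := integrand_gtNy hbeta r s.
case: (beta r s) => // [b _|_ _]; last by rewrite /= leNye.
rewrite -EFinB !lee_fin; lra.
Qed.

Lemma fenchel_le tau s : ((s * tau)%:E - beta r s <= conjugate beta r tau)%E.
Proof. by apply: ereal_sup_ubound; exists s. Qed.

Lemma conjugate_gtNy tau : (-oo < conjugate beta r tau)%E.
Proof. by apply: lt_le_trans (fenchel_le tau 1); rewrite betaE// -EFinB ltNyr. Qed.

(** Left of [s] the derivative is below [tau], right of it at least [tau], so [beta r x - tau * x]
    is minimal at [s] and the Fenchel supremum is attained there. *)
Lemma conjugate_slopeE tau s : S tau = s%:E ->
  beta r s \is a fin_num /\ conjugate beta r tau = ((s * tau)%:E - beta r s)%E.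
Proof.
move=> hS; have s0 : 0 <= s by rewrite -lee_fin -hS conjugate_slope_ge0.
have gts (x : R) : s < x -> tau <= dbeta beta r x.
  move=> sx; rewrite leNgt; apply/negP => /conjugate_slope_ge.
  by rewrite hS lee_fin leNgt sx => /(_ (le_lt_trans s0 sx)).
have lts (x : R) : 0 < x -> x < s -> dbeta beta r x < tau.
  by move=> x0 xs; apply: conjugate_slope_gt => //; rewrite hS lte_fin.
have key (y B : R) : 0 <= y -> (beta r y <= B%:E)%E ->
    (beta r s <= ((B - tau * y) + tau * s)%:E)%E.
  move=> y0 hB; have [sy|ys|ys] := ltgtP s y.
  - apply: beta_le_right => //; near=> x.
    have sx : s < x by near: x; exact: nbhs_right_gt.
    have xy : x < y by near: x; exact: nbhs_right_lt.
    have x0 : 0 < x by apply: le_lt_trans sx.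
    have := le_trans (tangent_le y x0) hB.
    have := ler_wpM2r (_ : 0 <= y - x) (gts _ sx).
    rewrite betaE// !lee_fin subr_ge0 ltW// => /(_ isT); lra.
  - have s1 : 0 < s by apply: le_lt_trans ys.
    apply: beta_le_left => //; near=> x.
    have sx : x < s by near: x; exact: nbhs_left_lt.
    have xy : y < x by near: x; exact: nbhs_left_gt.
    have x0 : 0 < x by apply: le_lt_trans xy.
    have := le_trans (tangent_le y x0) hB.
    have := ler_wpM2r (_ : 0 <= x - y) (ltW (lts _ x0 sx)).
    rewrite betaE// !lee_fin subr_ge0 ltW// => /(_ isT); lra.
  - by rewrite -ys subrK ys.
(* Comparison with the finite value at [s + 1]; this matters for [s = 0], where the integrand may be
   infinite. *)
have sfin : beta r s \is a fin_num.
  rewrite fin_numElt (integrand_gtNy hbeta)/=.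
  have s10 : 0 < s + 1 by lra.
  have := key (s + 1) (f (s + 1)) (ltW s10).
  rewrite betaE// => /(_ (lexx _)) /le_lt_trans; apply.
  by rewrite ltry.
split => //; apply/eqP; rewrite eq_le fenchel_le andbT.
have := key; rewrite -(fineK sfin) -EFinB => {}key.
apply/conjugate_leP => y y0.
have := integrand_gtNy hbeta r y.
case E : (beta r y) => [b| |]// _; last by rewrite leey.
have := key y b y0; rewrite E => /(_ (lexx _)).
rewrite !lee_fin; lra.
Unshelve. all: by end_near. Qed.

(** The converse of [conjugate_slopeE]: equality in Young's inequality pins down the slope. If they
    differed, the tangent at a point between [s] and the slope would contradict the Fenchel
    bound. *)
Lemma conjugate_slope_unique tau s b : 0 <= s -> beta r s = b%:E ->
  (conjugate beta r tau <= (s * tau - b)%:E)%E -> S tau = s%:E.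
Proof.
move=> s0 sb /conjugate_leP h.
have lts (x : R) : 0 < x -> dbeta beta r x < tau -> x <= s.
  move=> x0 hx; rewrite leNgt; apply/negP => sx.
  have := tangent_le s x0; have := h x (ltW x0).
  have : 0 < (x - s) * (tau - dbeta beta r x) by rewrite mulr_gt0// subr_gt0.
  rewrite sb betaE// !lee_fin; lra.
apply/eqP; rewrite eq_le; apply/andP; split.
  apply: ge_ereal_sup => _ [x /= [->|[x0 hx]] <-]; rewrite lee_fin//.
  exact: lts.
rewrite leNgt; apply/negP => hlt.
have [t t0 tE] := conjugate_slope_finP (lt_trans hlt (ltry _)).
move: hlt; rewrite tE lte_fin => ts.
(* Two points are used: the derivative is at least [tau] at [x], hence strictly above [tau] at
   [y]. *)
have [x [tx xs x0]] : exists x, [/\ t < x, x < s & 0 < x].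
  by exists ((t + s) / 2); split; lra.
have [y [xy ys y0]] : exists x', [/\ x < x', x' < s & 0 < x'].
  by exists ((x + s) / 2); split; lra.
have hx : tau <= dbeta beta r x.
  rewrite leNgt; apply/negP => /(conjugate_slope_ge x0); rewrite tE lee_fin; lra.
have hy : tau < dbeta beta r y by apply: le_lt_trans hx (dbeta_increasing _ _).
have := tangent_le s y0; have := h y (ltW y0).
have : 0 < (s - y) * (dbeta beta r y - tau) by rewrite mulr_gt0// subr_gt0.
rewrite sb betaE// !lee_fin; lra.
Qed.

Lemma conjugate_fin tau : (S tau < +oo)%E -> conjugate beta r tau \is a fin_num.
Proof.
move=> /conjugate_slope_finP[s _ /conjugate_slopeE[sfin ->]].
by rewrite fin_numB sfin.
Qed.

Lemma conjugate_subgradient tau s tau' : S tau = s%:E ->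
  (conjugate beta r tau + (s * (tau' - tau))%:E <= conjugate beta r tau')%E.
Proof.
move=> /conjugate_slopeE[sfin ->]; apply: le_trans (fenchel_le tau' s).
by rewrite -(fineK sfin) -!EFinB -EFinD lee_fin; lra.
Qed.

(** Strict convexity makes the generalized inverse continuous: the derivative of [beta r] is
    strictly above [tau] at [s + e] and, if [s - e] is positive, strictly below [tau] there. *)
Lemma conjugate_slope_near tau s (e : R) : S tau = s%:E -> 0 < e ->
  \forall h \near (0 : R),
    exists2 s', S (tau + h) = s'%:E & `|s' - s| <= e.
Proof.
move=> hS e0; have s0 : 0 <= s by rewrite -lee_fin -hS conjugate_slope_ge0.
have gt : tau < dbeta beta r (s + e).
  apply: (@le_lt_trans _ _ (dbeta beta r (s + e / 2))); last first.
    by apply: dbeta_increasing; lra.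
  rewrite leNgt; apply/negP => /conjugate_slope_ge.
  by rewrite hS lee_fin => /(_ ltac:(lra)); lra.
have upper : \forall h \near (0 : R), (S (tau + h) <= (s + e)%:E)%E.
  near=> h; apply: conjugate_slope_fin; first by lra.
  suff : h <= dbeta beta r (s + e) - tau by lra.
  by apply: ltW; near: h; apply: lt_nbhsl; lra.
have lower : \forall h \near (0 : R), ((s - e)%:E <= S (tau + h))%E.
  have [se|se] := leP (s - e) 0.
    by near=> h; apply: le_trans (conjugate_slope_ge0 _); rewrite lee_fin.
  have lt : dbeta beta r (s - e) < tau.
    by apply: conjugate_slope_gt => //; rewrite hS lte_fin; lra.
  near=> h; apply: conjugate_slope_ge => //.
  suff : dbeta beta r (s - e) - tau < h by lra.
  by near: h; apply: lt_nbhsr; lra.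
near=> h.
have hu : (S (tau + h) <= (s + e)%:E)%E by near: h.
have hl : ((s - e)%:E <= S (tau + h))%E by near: h.
have [s' _ hs'] := conjugate_slope_finP (le_lt_trans hu (ltry _)).
exists s' => //; move: hu hl; rewrite hs' !lee_fin ler_distl; lra.
Unshelve. all: by end_near. Qed.

(** The subgradient inequalities at [tau] and at [tau + h] place the quotient between [s] and the
    nearby slope [s']. *)
Lemma conjugate_cvg tau s : S tau = s%:E ->
  h^-1 * (fine (conjugate beta r (tau + h)) - fine (conjugate beta r tau))
    @[h --> (0 : R)^'] --> s.
Proof.
move=> hS; apply/cvgrPdist_le => e e0; near=> h.
have h0 : h != 0 by near: h; exact: nbhs_dnbhs_neq.
have [s' hS' ss'] : exists2 s', S (tau + h) = s'%:E & `|s' - s| <= e.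
  by near: h; apply: nbhs_dnbhs; apply: conjugate_slope_near.
have fin0 : conjugate beta r tau \is a fin_num by rewrite conjugate_fin// hS ltry.
have fin1 : conjugate beta r (tau + h) \is a fin_num.
  by rewrite conjugate_fin// hS' ltry.
have := conjugate_subgradient (tau + h) hS.
have := conjugate_subgradient tau hS'.
rewrite -(fineK fin0) -(fineK fin1) -!EFinD !lee_fin.
set c1 := fine _; set c0 := fine _ => h1 h2.
apply: le_trans ss'.
have hn : 0 < `|h| by rewrite normr_gt0.
rewrite -(ler_pM2r hn) -!normrM mulrBl mulrAC mulVf// mul1r.
by rewrite /= [leRHS]ger0_norm ?[leLHS]ler0_norm; lra.
Unshelve. all: by end_near. Qed.

Lemma dconjugateE tau s : S tau = s%:E -> dconjugate beta r tau = s.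
Proof.
move=> /conjugate_cvg h; rewrite /dconjugate derive1E /derive.
apply: cvg_lim => //; apply: cvg_trans h; apply: near_eq_cvg; near=> h.
by rewrite /= /GRing.scale/= mulr1 [h + tau]addrC.
Unshelve. all: by end_near. Qed.

Lemma lt_dbeta_pinfty tau : (tau%:E < dbeta_pinfty beta r)%E = (S tau < +oo)%E.
Proof.
(* The derivative is monotone on positive arguments only; freezing it below 1 gives a monotone
   function on the whole line with the same limit. *)
pose g s := (dbeta beta r (Num.max 1 s))%:E.
have gE : dbeta_pinfty beta r = ereal_sup (range g).
  apply: cvg_lim => //.
  have : g s @[s --> +oo] --> ereal_sup (range g).
    apply: nondecreasing_cvge => x y xy; rewrite lee_fin.
    have : Num.max 1 x <= Num.max 1 y by rewrite ge_max !le_max lexx/= xy orbT.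
    rewrite le_eqVlt => /predU1P[->//|lt]; apply/ltW/dbeta_increasing => //.
    by rewrite lt_max ltr01.
  apply: cvg_trans; apply: near_eq_cvg; near=> s.
  by rewrite /g max_r//; near: s; exact: nbhs_pinfty_ge.
rewrite gE; apply/idP/idP.
  move=> /ereal_sup_gt[_ [s _ <-]]; rewrite lte_fin => h.
  apply: le_lt_trans (ltry (Num.max 1 s)); apply: conjugate_slope_fin; last exact: ltW.
  by rewrite lt_max ltr01.
move=> /conjugate_slope_finP[s s0 hS].
have [s' hS' _] := nbhs_singleton (conjugate_slope_near hS ltr01).
have s10 : 0 < s + 1 by lra.
apply: (@lt_le_trans _ _ (dbeta beta r (s + 2))%:E); last first.
  by apply: ereal_sup_ubound; exists (s + 2) => //; rewrite /g max_r//; lra.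
rewrite lte_fin; apply: le_lt_trans (dbeta_increasing s10 _); last by lra.
rewrite leNgt; apply/negP => /(conjugate_slope_ge s10).
by rewrite hS lee_fin; lra.
Unshelve. all: by end_near. Qed.

(** Where the slope is infinite both sides are 0, since [fine] sends [+oo] to 0. *)
Lemma if_dconjugateE tau :
  (if (tau%:E < dbeta_pinfty beta r)%E then dconjugate beta r tau else 0) = fine (S tau).
Proof.
rewrite lt_dbeta_pinfty; case: ifPn => [/conjugate_slope_finP[s _ hs]|].
  by rewrite hs (dconjugateE hs).
by rewrite ltey negbK => /eqP ->.
Qed.

Lemma conjugate_homo tau tau' : tau <= tau' ->
  (conjugate beta r tau <= conjugate beta r tau')%E.
Proof.
move=> tt; apply: ge_ereal_sup => _ [s _ <-].
have [s0|s0] := leP 0 s; last by rewrite (integrand_neg hbeta)//= leNye.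
by apply: le_trans (fenchel_le tau' s); apply: leeB => //; rewrite lee_fin ler_wpM2l.
Qed.

Lemma conjugate_convex tau tau' A B t : 0 <= t <= 1 ->
  (conjugate beta r tau <= A%:E)%E -> (conjugate beta r tau' <= B%:E)%E ->
  (conjugate beta r (t * tau + (1 - t) * tau') <= (t * A + (1 - t) * B)%:E)%E.
Proof.
move=> /andP[t0 t1] /conjugate_leP hA /conjugate_leP hB; apply/conjugate_leP => s s0.
have := hA s s0; have := hB s s0; have := integrand_gtNy hbeta r s.
case: (beta r s) => [b| |]// _; last by rewrite !leey.
by rewrite !lee_fin; nra.
Qed.

(** An infinite slope can occur only at the right end of the domain of the conjugate. *)
Lemma conjugate_slope_below tau (e : R) : (conjugate beta r tau < +oo)%E -> 0 < e ->
  (S (tau - e) < +oo)%E.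
Proof.
move=> cfin e0; have fin : conjugate beta r tau \is a fin_num.
  by rewrite fin_numElt conjugate_gtNy.
pose c := fine (conjugate beta r tau).
(* For [s > 1] with derivative below [tau - e], the tangent at [s] evaluated at 1 and the Fenchel
   bound at [s] combine to [s * e <= B * e]. *)
pose B := (c - (dbeta beta r 1 - f 1)) / e.
apply: (@le_lt_trans _ _ (Num.max 1 B)%:E); last by rewrite ltry.
apply: ge_ereal_sup => _ [s /= [->|[s0 hs]] <-]; rewrite lee_fin le_max ?ler01//.
have [//|s1] := leP s 1; rewrite /= /B ler_pdivlMr//.
have hc : s * tau - f s <= c.
  by rewrite -lee_fin /c fineK// EFinB -betaE//; exact: fenchel_le.
have := tangent_pos s0 (@ltr01 R); have := dbeta_increasing ltr01 s1.
set D := dbeta beta r s; set D1 := dbeta beta r 1; rewrite -/D in hs => h1 h2.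
have : 0 < s * (tau - e - D) by rewrite mulr_gt0//; lra.
lra.
Qed.

End convex_integrand_pointwise.

(** * Measurability *)

Section pos_rationals.
Context {R : realType}.

(** An enumeration of the positive rationals; codes of anything else give 1, so that every term is
    positive. *)
Definition posq (n : nat) : R :=
  let q := odflt 1 (unpickle n : option rat) in if 0 < q then ratr q else 1.

Lemma posq_gt0 n : 0 < posq n.
Proof. by rewrite /posq; case: ifPn => //; rewrite ltr0q. Qed.

Lemma posq_dense (x y : R) : 0 <= x -> x < y -> exists n, x < posq n < y.
Proof.
move=> x0 xy; have [q] := rat_in_itvoo xy; rewrite in_itv/= => /andP[xq qy].
have q0 : 0 < q by rewrite -(ltr0q R); apply: le_lt_trans xq.
by exists (pickle q); rewrite /posq pickleK/= q0 xq.
Qed.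

End pos_rationals.

Lemma measurable_fun_ereal_sup_range d (T : measurableType d) (R : realType)
    (u : nat -> T -> \bar R) :
  (forall n, measurable_fun setT (u n)) ->
  measurable_fun setT (fun x => ereal_sup (range (u^~ x))).
Proof.
move=> mu; have := measurable_fun_esups mu 0%N.
suff -> : (fun x => esups (u^~ x) 0%N) = (fun x => ereal_sup (range (u^~ x))) by [].
apply/funext => x; congr (ereal_sup _); apply/seteqP.
by split => _ [n _ <-]; exists n.
Qed.

Section convex_integrand_measurable.
Context d (T : measurableType d) (R : realType) (beta : T -> R -> \bar R).
Hypothesis hbeta : convex_integrand beta.

(** Right continuity of [beta r], at 0 included, lets positive rationals replace all arguments in
    the supremum. *)
Lemma conjugate_posq r tau : conjugate beta r tau =
  ereal_sup (range (fun n => ((posq n * tau)%:E - beta r (posq n))%E)).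
Proof.
apply/eqP; rewrite eq_le; apply/andP; split; last first.
  by apply: ge_ereal_sup => _ [n _ <-]; exact: fenchel_le.
set M := ereal_sup _.
have hM n : ((posq n * tau)%:E - beta r (posq n) <= M)%E.
  by apply: ereal_sup_ubound; exists n.
case EM : M => [A| |]; last 2 first.
- by rewrite leey.
- have := hM 0%N; rewrite EM leeNy_eq => /eqP.
  by rewrite -(fineK (integrand_fin hbeta r (posq_gt0 0%N))) -EFinB.
apply/(conjugate_leP hbeta) => s s0.
rewrite leNgt; apply/negP => hlt.
have sfin : beta r s \is a fin_num.
  by rewrite fin_numElt (integrand_gtNy hbeta)/= (lt_trans hlt)// ltry.
have : \forall x \near s^'+, (beta r x + ((A - x * tau)%:E) < 0)%E.
  have hc : (beta r x + (A + - tau * x)%:E)%E @[x --> s^'+] --> (beta r s + (A + - tau * s)%:E)%E.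
    apply: cvgeD; first by rewrite fin_num_adde_defr.
      exact: (beta_cvg_right hbeta).
    exact/cvg_at_right_filter/affine_cvg.
  have neg : (beta r s + (A + - tau * s)%:E < 0)%E.
    by move: hlt; rewrite -(fineK sfin) -EFinD !lte_fin; lra.
  have : \forall x \near s^'+, (beta r x + (A + - tau * x)%:E < 0)%E.
    exact: hc _ (open_ereal_lt' neg).
  apply: filterS => x.
  by rewrite (_ : A + - tau * x = A - x * tau)//; ring.
move=> [e /= e0 he].
have [n /andP[sn ns]] := posq_dense s0 (ltac:(lra) : s < s + e).
have := he (posq n); rewrite /= ltr0_norm ?subr_lt0// => /(_ ltac:(lra) sn).
have := hM n; rewrite EM.
rewrite -(fineK (integrand_fin hbeta r (posq_gt0 n))) -EFinB -EFinD !lte_fin lee_fin.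
lra.
Qed.

(** Measurability is assumed at constant arguments only. Tangents at fixed rationals have measurable
    coefficients, and their supremum recovers [beta r p] even where it is [+oo]. *)
Lemma beta_posq r p : 0 <= p -> beta r p =
  ereal_sup (range (fun n => (fine (beta r (posq n)) +
    dbeta beta r (posq n) * (p - posq n))%:E)).
Proof.
move=> p0; apply/eqP; rewrite eq_le; apply/andP; split; last first.
  by apply: ge_ereal_sup => _ [n _ <-]; exact: (tangent_le hbeta _ _ (posq_gt0 n)).
set M := ereal_sup _.
have hM n : ((fine (beta r (posq n)) +
    dbeta beta r (posq n) * (p - posq n))%:E <= M)%E.
  by apply: ereal_sup_ubound; exists n.
case EM : M => [A| |]; last 2 first.
- by rewrite leey.
- by have := hM 0%N; rewrite EM leeNy_eq.
(* If [p < posq n < p + 1], the slope at [posq n] is below [D], so that tangent has at [p] a value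
   above [beta r (posq n)] minus [D * (posq n - p)]. *)
set D := dbeta beta r (p + 1).
have p1 : 0 < p + 1 by lra.
have : (beta r p <= ((A - D * p) + D * p)%:E)%E; last by rewrite subrK.
rewrite leNgt; apply/negP => hlt.
have : \forall x \near p^'+, (((A - D * p) + D * x)%:E < beta r x)%E.
  have hc : (beta r x - ((A - D * p) + D * x)%:E)%E @[x --> p^'+] -->
      (beta r p - ((A - D * p) + D * p)%:E)%E.
    apply: cvgeB; first by rewrite fin_num_adde_defl.
      exact: (beta_cvg_right hbeta).
    exact/cvg_at_right_filter/affine_cvg.
  have pos : (0 < beta r p - ((A - D * p) + D * p)%:E)%E by rewrite sube_gt0.
  have : \forall x \near p^'+, (0 < beta r x - ((A - D * p) + D * x)%:E)%E.
    exact: hc _ (open_ereal_gt' pos).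
  by apply: filterS => x; rewrite sube_gt0.
move=> [e /= e0 he].
have pe : p < p + Num.min 1 e by rewrite ltrDl lt_min ltr01.
have [n /andP[sn ns]] := posq_dense p0 pe.
have [n1 ne] : posq n < p + 1 /\ posq n < p + e.
  by move: ns; rewrite -ltrBlDl lt_min => /andP[]; split; lra.
have := he (posq n); rewrite /= ltr0_norm ?subr_lt0// => /(_ ltac:(lra) sn).
have := hM n; rewrite EM.
have := dbeta_increasing hbeta r (posq_gt0 n) n1.
rewrite -{2}(fineK (integrand_fin hbeta r (posq_gt0 n))) -!/D lte_fin lee_fin.
set b := fine _; set E := dbeta _ _ _ => h1 h2 h3.
have : 0 < (D - E) * (posq n - p) by rewrite mulr_gt0// subr_gt0.
lra.
Qed.

Lemma conjugate_slope_posq r tau : conjugate_slope beta r tau =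
  ereal_sup (range (fun n => if dbeta beta r (posq n) < tau then (posq n)%:E else 0%E)).
Proof.
apply/eqP; rewrite eq_le; apply/andP; split; last first.
  apply: ge_ereal_sup => _ [n _ <-]; case: ifPn => h.
    by apply: conjugate_slope_ge => //; exact: posq_gt0.
  exact: conjugate_slope_ge0.
apply: ge_ereal_sup => _ [s /= [->|[s0 hs]] <-].
  apply: (@le_trans _ _ (if dbeta beta r (posq 0) < tau then (posq 0)%:E else 0%E)).
    by case: ifPn => // _; rewrite lee_fin ltW// posq_gt0.
  by apply: ereal_sup_ubound; exists 0%N.
apply/lee_addgt0Pr => e e0; rewrite -leeBlDr//.
have [se|se] := leP s e.
  apply: (@le_trans _ _ (if dbeta beta r (posq 0) < tau then (posq 0)%:E else 0%E)).
    rewrite -EFinB; case: ifPn => _; rewrite lee_fin; last lra.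
    by have := @posq_gt0 R 0%N; lra.
  by apply: ereal_sup_ubound; exists 0%N.
have [n /andP[sn ns]] := posq_dense (ltac:(lra) : 0 <= s - e) (ltac:(lra) : s - e < s).
apply: (@le_trans _ _ (posq n)%:E); first by rewrite -EFinB lee_fin ltW.
apply: ereal_sup_ubound; exists n => //.
by rewrite ifT//; apply: lt_trans hs; apply: (dbeta_increasing hbeta) => //; exact: posq_gt0.
Qed.

Lemma measurable_fine_beta (s : R) : measurable_fun setT (fun r => fine (beta r s)).
Proof. by apply: measurableT_comp => //; exact: (integrand_measurable hbeta). Qed.

Lemma measurable_dbeta (s : R) : 0 < s -> measurable_fun setT (fun r => dbeta beta r s).
Proof.
move=> s0.
apply: (@measurable_fun_cvg _ _ _ _ (fun n r => (n.+1%:R^-1)^-1 *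
    (fine (beta r (s + n.+1%:R^-1)) - fine (beta r s)))).
  move=> n; apply: measurable_funM => //.
  by apply: measurable_funB; exact: measurable_fine_beta.
move=> r _.
have /cvg_dnbhs_at_right/cvg_at_rightP := dbeta_cvg hbeta (r := r) s0.
by apply; split; [move=> n; rewrite invr_gt0|exact: cvg_harmonic].
Qed.

Lemma measurable_conjugate (tau : T -> R) : measurable_fun setT tau ->
  measurable_fun setT (fun r => conjugate beta r (tau r)).
Proof.
move=> mtau; under eq_fun do rewrite conjugate_posq.
apply: measurable_fun_ereal_sup_range => n; apply: emeasurable_funB.
  by apply/measurable_EFinP; apply: measurable_funM.
exact: (integrand_measurable hbeta).
Qed.

Lemma measurable_beta (p : T -> R) : measurable_fun setT p -> (forall r, 0 <= p r) ->
  measurable_fun setT (fun r => beta r (p r)).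
Proof.
move=> mp p0; under eq_fun do rewrite (beta_posq _ (p0 _)).
apply: measurable_fun_ereal_sup_range => n; apply/measurable_EFinP.
apply: measurable_funD; first exact: measurable_fine_beta.
apply: measurable_funM; first exact/measurable_dbeta/posq_gt0.
exact: measurable_funB.
Qed.

Lemma measurable_conjugate_slope (tau : T -> R) : measurable_fun setT tau ->
  measurable_fun setT (fun r => conjugate_slope beta r (tau r)).
Proof.
move=> mtau; under eq_fun do rewrite conjugate_slope_posq.
apply: measurable_fun_ereal_sup_range => n.
apply: measurable_fun_ifT => //.
by apply: measurable_fun_ltr => //; exact/measurable_dbeta/posq_gt0.
Qed.

End convex_integrand_measurable.

(** * Multipliers and real-valued integrals *)

Lemma half_in01 (R : realType) : 0 <= (2^-1 : R) <= 1.
Proof. by apply/andP; split; lra. Qed.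

Lemma midpoint_equality (R : realType) (s x y z a c b : R) :
  z = s * (x + 2^-1 * (y - x)) - b -> 2^-1 * (a + c) - z = 0 ->
  s * x - b <= a -> s * y - b <= c -> a <= s * x - b /\ c <= s * y - b.
Proof. by move=> -> hr h1 h2; split; lra. Qed.

Lemma convex_combination_le (R : realType) (l K t u kt ku a b e : R) : 0 <= l <= 1 ->
  K <= (1 - l) * kt + l * ku -> kt - t < a + e -> ku - u < b + e ->
  K - (t + l * (u - t)) <= a + l * (b - a) + e.
Proof.
move=> /andP[l0 l1] hK ht hu.
have : (1 - l) * (kt - t) <= (1 - l) * (a + e) by rewrite ler_wpM2l//; lra.
have : l * (ku - u) <= l * (b + e) by rewrite ler_wpM2l//; lra.
lra.
Qed.

Section multiplier.
Context {R : realType} (V : Type) (D : set V) (a h : V -> R).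
Hypothesis mix : forall p q t, D p -> D q -> 0 <= t <= 1 ->
  exists z, [/\ D z, a z = t * a p + (1 - t) * a q & h z <= t * h p + (1 - t) * h q].

(** Separation in the plane of the pairs [(a p, h p)]: each quotient [h / a] from the side [a < 0]
    is at most each one from the side [a > 0], because mixing the two points reaches [a = 0], where
    [h] is nonnegative. The supremum of the left quotients serves. *)
Lemma multiplier_exists : (exists2 p, D p & 0 < a p) -> (exists2 p, D p & a p < 0) ->
  (forall p, D p -> a p = 0 -> 0 <= h p) ->
  exists th, forall p, D p -> th * a p <= h p.
Proof.
move=> [q0 Dq0 aq0] [p1 Dp1 ap1] h0.
have key p q : D p -> D q -> a p < 0 -> 0 < a q -> h p / a p <= h q / a q.
  move=> Dp Dq ap aq; have dpos : 0 < a q - a p by lra.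
  (* The weight for which [a] vanishes on the mixture. *)
  have t01 : 0 <= a q / (a q - a p) <= 1.
    apply/andP; split; first by rewrite divr_ge0 ?ltW.
    by rewrite ler_pdivrMr//; lra.
  have [z [Dz az hz]] := mix Dp Dq t01.
  have : 0 <= h z by apply: h0 => //; rewrite az; field; rewrite gt_eqF.
  move=> /le_trans/(_ hz).
  have -> : a q / (a q - a p) * h p + (1 - a q / (a q - a p)) * h q =
    (h p * a q - h q * a p) / (a q - a p) by field; rewrite gt_eqF.
  rewrite pmulr_lge0 ?invr_gt0// => h1.
  rewrite ler_ndivrMr// mulrAC ler_pdivrMr//; lra.
exists (sup [set h p / a p | p in [set p | D p /\ a p < 0]]) => p Dp.
set E := [set _ | _ in _].
have Eub q : D q -> 0 < a q -> ubound E (h q / a q).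
  by move=> Dq aq _ [p' [Dp' ap'] <-]; exact: key.
have E0 : E !=set0 by exists (h p1 / a p1), p1.
have [ap|ap|ap] := ltgtP (a p) 0.
- rewrite -ler_ndivrMr//; apply: ub_le_sup; last by exists p.
  by exists (h q0 / a q0); exact: Eub.
- by rewrite -ler_pdivlMr//; apply: ge_sup => //; exact: Eub.
- by rewrite ap mulr0 h0.
Qed.

End multiplier.

(** * Real-valued integrable functions *)

Section integrable_real.
Context d (T : measurableType d) (R : realType) (mu : {measure set T -> \bar R}).
Implicit Types f g : T -> R.

Definition integrable_real f : bool := mu.-integrable setT (EFin \o f).

Local Notation Int := integrable_real.

Lemma integrable_real_measurable f : Int f -> measurable_fun setT f.
Proof. by move=> /measurable_int /measurable_EFinP. Qed.

Lemma integrable_realD f g : Int f -> Int g -> Int (fun r => f r + g r).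
Proof. exact: integrableD. Qed.

Lemma integrable_realB f g : Int f -> Int g -> Int (fun r => f r - g r).
Proof. exact: integrableB. Qed.

Lemma integrable_realZ k f : Int f -> Int (fun r => k * f r).
Proof. exact: integrableZl. Qed.

Lemma integrable_real_norm f : Int f -> Int (fun r => `|f r|).
Proof. exact: integrable_norm. Qed.

Lemma integrable_real_le f g : measurable_fun setT f -> (forall r, `|f r| <= g r) ->
  Int g -> Int f.
Proof.
move=> mf fg ig; apply: (le_integrable measurableT _ _ ig).
  exact/measurable_EFinP.
by move=> r _; rewrite /= lee_fin (le_trans (fg r))// ler_norm.
Qed.

Lemma integrable_real_between f g h : measurable_fun setT f ->
  (forall r, g r <= f r <= h r) -> Int g -> Int h -> Int f.
Proof.
move=> mf gfh ig ih; apply: (@integrable_real_le _ (fun r => `|g r| + `|h r|)) => //.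
  move=> r; have /andP[gf fh] := gfh r.
  have := ler_norm (h r); have := ler_norm (- g r); rewrite normrN => h1 h2.
  rewrite ler_norml; apply/andP; split; first by have := normr_ge0 (h r); lra.
  by have := normr_ge0 (g r); lra.
by apply: integrable_realD; exact: integrable_real_norm.
Qed.

Lemma integrable_real_if (a : T -> bool) f g : measurable_fun setT a ->
  Int f -> Int g -> Int (fun r => if a r then f r else g r).
Proof.
move=> ma fi gi; apply: (@integrable_real_le _ (fun r => `|f r| + `|g r|)).
- by apply: measurable_fun_ifT => //; exact: integrable_real_measurable.
- by move=> r; case: ifP => _; rewrite ?lerDl ?lerDr.
- by apply: integrable_realD; exact: integrable_real_norm.
Qed.

Lemma integrable_real0 : Int (fun=> 0).
Proof. exact: integrable0. Qed.

Lemma integrable_real_bounded (a : T -> bool) f M : measurable_fun setT a ->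
  (mu [set r | a r] < +oo)%E -> measurable_fun setT f ->
  (forall r, a r -> `|f r| <= M) -> Int (fun r => if a r then f r else 0).
Proof.
move=> ma afin mf fM; pose A : set T := [set r | a r].
have mA : measurable A.
  by have := ma measurableT [set true]; rewrite setTI; apply.
apply: (@integrable_real_le _ (fun r => `|M| * \1_A r)).
- exact: measurable_fun_ifT.
- move=> r; case: ifPn => h.
    by rewrite indicE mem_set// mulr1 (le_trans (fM _ h))// ler_norm.
  by rewrite normr0 mulr_ge0.
- apply: integrable_realZ; apply/integrableP; split.
    by apply/measurable_EFinP; exact: measurable_indic.
  rewrite (_ : (fun x => _) = (fun x => (\1_A x)%:E)); last first.
    by apply/funext => x /=; rewrite ger0_norm.
  by rewrite integral_indic// setIT.
Qed.

Lemma integrable_real_patch (a : T -> bool) f g M : measurable_fun setT a ->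
  (mu [set r | a r] < +oo)%E -> measurable_fun setT f ->
  (forall r, a r -> `|f r| <= M) -> Int g -> Int (fun r => if a r then f r else g r).
Proof.
move=> ma afin mf fM gi; have h1 := integrable_real_bounded ma afin mf fM.
have := integrable_realD h1 (integrable_real_if ma integrable_real0 gi).
by congr (Int _); apply/funext => r; case: ifP => _; rewrite ?addr0 ?add0r.
Qed.

Lemma le_Rintegral_setT f g : Int f -> Int g -> (forall r, f r <= g r) ->
  \int[mu]_r f r <= \int[mu]_r g r.
Proof. by move=> fi gi fg; apply: le_Rintegral. Qed.

Lemma cvg_Rintegral_if (a : nat -> T -> bool) f : Int f ->
  (forall n, measurable_fun setT (a n)) ->
  (forall r, \forall n \near \oo, a n r) ->
  \int[mu]_r (if a n r then f r else 0) @[n --> \oo] --> \int[mu]_r f r.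
Proof.
move=> fi ma acov; apply: fine_cvg; rewrite fineK; last first.
  exact: integrable_fin_num.
apply: (@dominated_cvg _ _ _ mu _ measurableT _ _ (fun r => `|f r|%:E)).
- move=> n; apply/measurable_EFinP; apply: measurable_fun_ifT => //.
  exact: integrable_real_measurable.
- move=> r _; apply: cvg_near_cst.
  by apply: filterS (acov r) => n ->.
- by [].
- exact: integrable_real_norm.
- by move=> n r _ /=; case: ifP => _; rewrite ?normr0 lee_fin.
Qed.

(** Monotone convergence for functions of any sign, applied after subtracting [u 0]; the common
    bound [A] makes the limit integrable. *)
Lemma monotone_limit_integrable (u : nat -> T -> R) (f : T -> \bar R) (A : R) :
  (forall i, Int (u i)) -> (forall r i j, (i <= j)%N -> u i r <= u j r) ->
  (forall r, f r = ereal_sup (range (fun i => (u i r)%:E))) ->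
  (forall i, \int[mu]_r u i r <= A) ->
  mu.-integrable setT f /\ (\int[mu]_r f r <= A%:E)%E.
Proof.
move=> ui uh fE uA.
have ucvg r : (u i r)%:E @[i --> \oo] --> f r.
  by rewrite fE; apply: ereal_nondecreasing_cvgn => i j ij; rewrite lee_fin uh.
have mf : measurable_fun setT f.
  apply: (@emeasurable_fun_cvg _ _ _ _ (fun i r => (u i r)%:E)) => //.
  by move=> i; apply/measurable_EFinP; exact: integrable_real_measurable.
pose g i r := (u i r - u 0%N r)%:E.
have gi i : mu.-integrable setT (g i) by exact: (integrable_realB (ui i) (ui 0%N)).
have glim r : limn (g^~ r) = (f r - (u 0%N r)%:E)%E.
  apply: cvg_lim => //; under eq_fun do rewrite /g EFinB.
  by apply: cvgeB => //; [rewrite fin_num_adde_defl|exact: cvg_cst].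
have gh r i j : (i <= j)%N -> (g i r <= g j r)%E.
  by move=> ij; rewrite lee_fin lerB// uh.
have := @cvg_monotone_convergence _ _ _ mu _ measurableT g
  (fun n => measurable_int _ (gi n)).
have g0 n x : setT x -> (0 <= g n x)%E by move=> _; rewrite lee_fin subr_ge0 uh.
move=> /(_ g0 (fun x _ => gh x)).
under eq_integral do rewrite glim.
move=> hc.
have le1 : (\int[mu]_r (f r - (u 0%N r)%:E) <= (A - \int[mu]_r u 0%N r)%:E)%E.
  apply: cvge_le hc; apply: nearW => i; rewrite /g.
  rewrite -[leLHS]fineK ?(integrable_fin_num measurableT (gi i))// lee_fin.
  rewrite -[fine _]/(Rintegral _ _ _) RintegralB//; [|exact: ui..].
  by rewrite lerB.
have f0 r : (0 <= f r - (u 0%N r)%:E)%E.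
  by rewrite sube_ge0 ?fin_numE// fE; apply: ereal_sup_ubound; exists 0%N.
have fi0 : mu.-integrable setT (fun r => f r - (u 0%N r)%:E)%E.
  apply/integrableP; split.
    by apply: emeasurable_funB => //; apply/measurable_EFinP; exact: integrable_real_measurable.
  under eq_integral do rewrite gee0_abs//.
  by apply: le_lt_trans le1 _; rewrite ltry.
have fE2 : f = (fun r => (f r - (u 0%N r)%:E) + (u 0%N r)%:E)%E.
  by apply/funext => r; rewrite subeK.
split; first by rewrite fE2; apply: integrableD => //; exact: (ui 0%N).
rewrite fE2 integralD//; last exact: (ui 0%N).
have -> : (\int[mu]_x (u 0%N x)%:E = (\int[mu]_r u 0%N r)%:E)%E.
  by rewrite /Rintegral fineK//; exact: (integrable_fin_num measurableT (ui 0%N)).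
by rewrite -leeBrDr// -EFinB.
Qed.

Lemma integral_or_pinfty_integrable (f : T -> \bar R) : mu.-integrable setT f ->
  integral_or_pinfty mu f = (\int[mu]_r f r)%E.
Proof.
move=> fi; rewrite /integral_or_pinfty asboolT//; left.
exact: integral_funepos_lt_pinfty.
Qed.

(** Undefined integrals count as [+oo], so a finite value means that one of the two parts has a
    finite integral, and then so has the other. *)
Lemma integral_or_pinfty_lty (f : T -> \bar R) : measurable_fun setT f ->
  (integral_or_pinfty mu f < +oo)%E -> (-oo < integral_or_pinfty mu f)%E ->
  mu.-integrable setT f.
Proof.
move=> mf; rewrite /integral_or_pinfty; case: asboolP => // def hy hNy.
have fin : (\int[mu]_r f r)%E \is a fin_num by rewrite fin_numElt hNy.
apply/integrableP; split => //.
have -> : (fun x => `|f x|)%E = (fun x => f^\+ x + f^\- x)%E.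
  by apply/funext => x; rewrite -[LHS]/((abse \o f) x) fune_abse.
rewrite ge0_integralD//; [|exact: measurable_funepos|exact: measurable_funeneg].
move: fin; rewrite integralE => fin.
have p0 : (0 <= \int[mu]_r f^\+ r)%E by exact: integral_ge0.
have n0 : (0 <= \int[mu]_r f^\- r)%E by exact: integral_ge0.
move: fin def p0 n0; rewrite /integral_defined.
by case: (\int[mu]_r f^\+ r)%E; case: (\int[mu]_r f^\- r)%E => //= *; rewrite ?ltry//; case: def.
Qed.

Lemma integral_real f : Int f -> (\int[mu]_r (f r)%:E = (\int[mu]_r f r)%:E)%E.
Proof.
by move=> fi; rewrite /Rintegral fineK//; exact: (integrable_fin_num measurableT fi).
Qed.

Lemma ae_eq_integrable (f g : T -> \bar R) : mu.-integrable setT f ->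
  measurable_fun setT g -> ae_eq mu setT f g ->
  mu.-integrable setT g /\ (\int[mu]_r g r = \int[mu]_r f r)%E.
Proof.
move=> fi mg fg; have mf := measurable_int mu fi; split.
  apply/integrableP; split => //.
  rewrite (ae_eq_integral (abse \o f))//.
  - by move/integrableP : fi => [].
  - exact: measurableT_comp.
  - exact: measurableT_comp.
  - by apply: filterS fg => r h rT /=; rewrite h.
by apply: ae_eq_integral => //; exact: ae_eq_sym.
Qed.

Lemma ae_eq_integrable_real f g : Int f -> measurable_fun setT g -> ae_eq mu setT f g ->
  Int g /\ \int[mu]_r g r = \int[mu]_r f r.
Proof.
move=> fi mg fg.
have mEg : measurable_fun setT (EFin \o g) by exact/measurable_EFinP.
have ae : ae_eq mu setT (EFin \o f) (EFin \o g).
  by apply: filterS fg => r h rT /=; rewrite h.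
by have [gi gE] := ae_eq_integrable fi mEg ae; rewrite /Rintegral gE.
Qed.

Lemma integrable_real_fineK (f : T -> \bar R) : (forall r, f r \is a fin_num) ->
  mu.-integrable setT f -> Int (fun r => fine (f r)).
Proof.
move=> ff; rewrite /integrable_real (_ : EFin \o _ = f)//.
by apply/funext => r /=; rewrite fineK.
Qed.

Lemma le_Rintegral_ae f g : Int f -> Int g -> (\forall r \ae mu, f r <= g r) ->
  \int[mu]_r f r <= \int[mu]_r g r.
Proof.
move=> fi gi fg; pose h r := if f r <= g r then f r else g r.
have mf := integrable_real_measurable fi; have mg := integrable_real_measurable gi.
have ih : Int h by apply: integrable_real_if => //; exact: measurable_fun_ler.
have ae : ae_eq mu setT f h by apply: filterS fg => r h0 _; rewrite /h h0.
have [_ <-] := ae_eq_integrable_real fi (integrable_real_measurable ih) ae.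
by apply: le_Rintegral_setT => // r; rewrite /h; case: ifP.
Qed.

End integrable_real.

(** * Perturbations of the default density *)

Section worst_case_duality.
Context d (T : measurableType d) (R : realType) (mu : {measure set T -> \bar R}).
Variables (beta : T -> R -> \bar R) (X p0 : T -> R) (core : nat -> T -> bool).

Local Notation Int := (integrable_real mu).
Local Notation b p := (fun r => fine (beta r (p r))).

(** Cores are where functions may be altered freely: finite measure and bounded [X] keep mass and
    expectation finite, and the bounded tangent of [beta r] at 1 keeps energies bounded below. *)
Record exhaustion : Prop := Exhaustion {
  core_measurable : forall n, measurable_fun setT (core n) ;
  core_finite : forall n, (mu [set r | core n r] < +oo)%E ;
  core_homo : forall m n r, (m <= n)%N -> core m r -> core n r ;
  core_cover : forall r, exists n, core n r ;
  core_bound : forall n r, core n r -> [/\ `|X r| <= n%:R,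
    `|fine (beta r 1)| <= n%:R & `|dbeta beta r 1| <= n%:R] }.

(** Finiteness of [beta r (p r)] is imposed at every point so that [fine] loses nothing and energies
    are real integrals; [density_profile] provides such representatives. *)
Record integrable_profile (p : T -> R) : Prop := IntegrableProfile {
  profile_measurable : measurable_fun setT p ;
  profile_ge0 : forall r, 0 <= p r ;
  profile_fin : forall r, beta r (p r) \is a fin_num ;
  profile_int : Int p ;
  profile_intX : Int (fun r => X r * p r) ;
  profile_intb : Int (b p) }.

(* Only such perturbations of [p0] are available: the energy of [c * p0] may be infinite
   for every [c != 1]. *)
Definition local_perturbation (p : T -> R) : Prop :=
  integrable_profile p /\ exists n, forall r, ~~ core n r -> p r = p0 r.

Local Notation ip := integrable_profile.
Local Notation lp := local_perturbation.
Local Notation mass p := (\int[mu]_r p r).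
Local Notation ex p := (\int[mu]_r (X r * p r)).
Local Notation en p := (\int[mu]_r fine (beta r (p r))).

Hypothesis hbeta : convex_integrand beta.
Hypothesis hX : measurable_fun setT X.
Hypothesis hp0 : integrable_profile p0.
Hypothesis hcore : exhaustion.

Definition mixture t (p q : T -> R) r := t * p r + (1 - t) * q r.

Lemma mixture_le t p q r : ip p -> ip q -> 0 <= t <= 1 ->
  beta r (mixture t p q r) \is a fin_num /\ b (mixture t p q) r <= t * b p r + (1 - t) * b q r.
Proof.
move=> hp hq t01.
have := beta_convex hbeta (profile_ge0 hp r) (profile_ge0 hq r) t01 (A := b p r) (B := b q r).
move=> /(_ r); rewrite !fineK ?(profile_fin hp)// ?(profile_fin hq)// => /(_ (lexx _) (lexx _)) h.
have fin : beta r (mixture t p q r) \is a fin_num.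
  by rewrite fin_numElt (integrand_gtNy hbeta) (le_lt_trans h)// ltry.
by split => //; rewrite -lee_fin fineK.
Qed.

(** Convexity bounds the energy of a mixture from above only. The minorant [g] comes from tangents
    on a core in [mixture_local], and from [hH] in [mixture_density]. *)
Lemma mixture_profile t p q g : ip p -> ip q -> 0 <= t <= 1 ->
  Int g -> (forall r, g r <= b (mixture t p q) r) ->
  [/\ ip (mixture t p q), mass (mixture t p q) = t * mass p + (1 - t) * mass q,
    ex (mixture t p q) = t * ex p + (1 - t) * ex q &
    en (mixture t p q) <= t * en p + (1 - t) * en q].
Proof.
move=> hp hq t01 ig hg.
have [mp p0' pf pi pX pb] := hp; have [mq q0 qf qi qX qb] := hq.
have Z := integrable_realZ.
have mix0 r : 0 <= mixture t p q r.
  by move: t01 => /andP[t0 t1]; rewrite addr_ge0// mulr_ge0// subr_ge0.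
have mm : measurable_fun setT (mixture t p q).
  by apply: measurable_funD; apply: measurable_funM.
have XE : (fun r => X r * mixture t p q r) =
    (fun r => t * (X r * p r) + (1 - t) * (X r * q r)).
  by apply/funext => r; rewrite /mixture; ring.
have mb : measurable_fun setT (b (mixture t p q)).
  by apply: measurableT_comp => //; exact: measurable_beta.
have ub : Int (fun r => t * b p r + (1 - t) * b q r).
  by apply: integrable_realD; exact: Z.
have ib : Int (b (mixture t p q)).
  apply: (integrable_real_between mb) ig ub => r; rewrite hg.
  exact: (mixture_le _ hp hq t01).2.
have D f h : Int f -> Int h -> \int[mu]_r (t * f r + (1 - t) * h r) =
    t * \int[mu]_r f r + (1 - t) * \int[mu]_r h r.
  by move=> fi hi; rewrite RintegralD ?RintegralZl//; exact: Z.
split.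
- split => //.
  + by move=> r; exact: (mixture_le _ hp hq t01).1.
  + by apply: integrable_realD; exact: Z.
  + by rewrite XE; apply: integrable_realD; exact: Z.
- exact: D.
- by rewrite XE; exact: D.
- rewrite -D//; apply: le_Rintegral_setT => // r.
  exact: (mixture_le _ hp hq t01).2.
Qed.

(* On [core n] the tangent of [beta r] at 1 gives an integrable lower bound. *)
Lemma mixture_local t p q : lp p -> lp q -> 0 <= t <= 1 ->
  [/\ lp (mixture t p q), mass (mixture t p q) = t * mass p + (1 - t) * mass q,
    ex (mixture t p q) = t * ex p + (1 - t) * ex q &
    en (mixture t p q) <= t * en p + (1 - t) * en q].
Proof.
move=> [hp [n1 pE]] [hq [n2 qE]] t01.
pose n := maxn n1 n2; pose N : R := n%:R.
have mE r : ~~ core n r -> mixture t p q r = p0 r.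
  move=> nr; rewrite /mixture pE ?qE; first by ring.
    by apply: contra nr; apply: (core_homo hcore); rewrite leq_maxr.
  by apply: contra nr; apply: (core_homo hcore); rewrite leq_maxl.
have [t0 t1] := andP t01.
have mcore := core_measurable hcore n.
(* On the core, [- N - N] minus [N] times the mixture bounds the tangent at 1 from below; off the
   core the mixture is [p0] and the subtracted terms are nonnegative. *)
pose g r := (if core n r then - N - N else b p0 r) - N * (t * p r + (1 - t) * q r)
  - N * p0 r.
have [||] := @mixture_profile t p q g hp hq t01.
- apply: integrable_realB; last exact/integrable_realZ/profile_int.
  apply: integrable_realB; last first.
    apply/integrable_realZ/integrable_realD; apply/integrable_realZ; exact: profile_int.
  apply: (integrable_real_patch (M := N + N)) => //.
  + exact: (core_finite hcore).
  + by move=> r _; rewrite ler_norml; have : 0 <= N by []; lra.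
  + exact: profile_intb.
- move=> r; rewrite /g; have N0 : 0 <= N by [].
  have pr0 := profile_ge0 hp r; have qr0 := profile_ge0 hq r.
  have p0r := profile_ge0 hp0 r.
  have h1 : 0 <= N * p0 r by rewrite mulr_ge0.
  have h0 : 0 <= t * p r + (1 - t) * q r by rewrite addr_ge0// mulr_ge0//; lra.
  have h2 : 0 <= N * (t * p r + (1 - t) * q r) by rewrite mulr_ge0.
  case: ifPn => [cr|cr]; last by rewrite mE//; lra.
  have [_ f1 d1] := core_bound hcore cr.
  have [fin _] := mixture_le r hp hq t01.
  have := tangent_le hbeta r (mixture t p q r) (@ltr01 R).
  rewrite -(fineK fin) lee_fin; apply: le_trans.
  move: f1 d1; rewrite /mixture !ler_norml => /andP[f1 _] /andP[d1 d2].
  set z := t * p r + _ in h0 h2 *.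
  have : - (N * z) <= dbeta beta r 1 * z by rewrite -mulNr ler_wpM2r.
  rewrite -/N in f1 d1 d2; lra.
- by move=> hip -> -> ?; split => //; split => //; exists n.
Qed.

Lemma core_sub_finite n (a : T -> bool) : measurable_fun setT a ->
  (forall r, a r -> core n r) -> (mu [set r | a r] < +oo)%E.
Proof.
have mT (c : T -> bool) : measurable_fun setT c -> measurable [set r | c r].
  by move=> mc; have := mc measurableT [set true]; rewrite setTI; apply.
move=> ma ac; apply: le_lt_trans (core_finite hcore n); apply: le_measure; rewrite ?inE.
- exact: mT.
- exact/mT/(core_measurable hcore).
- by move=> r /= /ac.
Qed.

Lemma local_p0 : lp p0.
Proof. by split => //; exists 0%N. Qed.

(** * Switching to a given function on sets of finite measure *)

Section good.
Variable q : T -> R.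
Hypotheses (mq : measurable_fun setT q) (q0 : forall r, 0 <= q r).
Hypothesis qfin : forall r, beta r (q r) \is a fin_num.

(** These sets exhaust the space, and on each of them [q], its energy and [X * q] are bounded, so
    switching to [q] there preserves integrability. *)
Definition good n r : bool := [&& core n r, q r <= n%:R & `|b q r| <= n%:R].

Let mb : measurable_fun setT (b q).
Proof. by apply: measurableT_comp => //; exact: measurable_beta. Qed.

Lemma good_measurable n : measurable_fun setT (good n).
Proof.
apply: measurable_and; first exact: (core_measurable hcore).
by apply: measurable_and; apply: measurable_fun_ler => //; exact: measurableT_comp.
Qed.

Lemma good_homo m n r : (m <= n)%N -> good m r -> good n r.
Proof.
move=> mn /and3P[h1 h2 h3]; have mn' : m%:R <= n%:R :> R by rewrite ler_nat.
by apply/and3P; split; [exact: (core_homo hcore) h1|exact: le_trans mn'|exact: le_trans mn'].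
Qed.

Lemma good_cover r : \forall n \near \oo, good n r.
Proof.
have [n hn] := core_cover hcore r.
near=> m; apply/and3P; split.
- by apply: (core_homo hcore) hn; near: m; exact: nbhs_infty_ge.
- by near: m; exact: nbhs_infty_ger.
- by near: m; exact: nbhs_infty_ger.
Unshelve. all: by end_near. Qed.

Lemma patch_local p n (a : T -> bool) : lp p -> measurable_fun setT a ->
  (forall r, a r -> good n r) -> lp (fun r => if a r then q r else p r).
Proof.
move=> [hp [n1 pE]] ma ag; have [mp p0' pf pi pX pb] := hp.
have afin : (mu [set r | a r] < +oo)%E.
  by apply: (core_sub_finite (n := n)) => // r /ag /and3P[].
have n0 : 0 <= n%:R :> R by [].
split; last first.
  exists (maxn n1 n) => r nr; case: ifPn => ar.
    have /and3P[cr _ _] := ag _ ar; move: nr.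
    by rewrite (core_homo hcore _ cr)// leq_maxr.
  apply: pE; apply: contra nr; apply: (core_homo hcore); exact: leq_maxl.
split.
- exact: measurable_fun_ifT.
- by move=> r; case: ifP.
- by move=> r; case: ifP.
- apply: (integrable_real_patch (M := n%:R)) => // r /ag /and3P[_ h _].
  by rewrite ger0_norm.
- rewrite (_ : (fun r => _) = (fun r => if a r then X r * q r else X r * p r)); last first.
    by apply/funext => r; case: ifP.
  apply: (integrable_real_patch (M := n%:R * n%:R)) => //.
    exact: measurable_funM.
  move=> r /ag /and3P[cr h _]; have [Xr _ _] := core_bound hcore cr.
  by rewrite normrM ler_pM// ger0_norm.
- rewrite (_ : (fun r => _) = (fun r => if a r then b q r else b p r)); last first.
    by apply/funext => r; case: ifP.
  by apply: (integrable_real_patch (M := n%:R)) => // r /ag /and3P[].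
Qed.

End good.

(** * Interchange of supremum and integral *)

Section interchange.
Variables (t1 t2 : R).
Let tau r := t1 + t2 * X r.
Let psi (p : T -> R) r := tau r * p r - b p r.

(** Each pair of a rational index and a level [N] has its turn, at step [pickle (k, N)]. A switch is
    made only where it raises [psi], so no earlier gain is lost. *)
Fixpoint greedy (i : nat) : T -> R :=
  if i is j.+1 then
    let kN := odflt (0, 0)%N (unpickle j : option (nat * nat)) in
    fun r => if good (fun=> posq kN.1) kN.2 r &&
      (psi (greedy j) r < psi (fun=> posq kN.1) r) then posq kN.1 else greedy j r
  else p0.

Let mtau : measurable_fun setT tau.
Proof. by apply: measurable_funD => //; exact: measurable_funM. Qed.

Let mpsi p : ip p -> measurable_fun setT (psi p).
Proof.
move=> hp; apply: measurable_funB.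
  by apply: measurable_funM => //; exact: profile_measurable.
exact/integrable_real_measurable/profile_intb.
Qed.

Let mcst (s : R) : 0 < s -> measurable_fun setT (psi (fun=> s)).
Proof.
move=> s0; apply: measurable_funB; first exact: measurable_funM.
exact: measurable_fine_beta.
Qed.

Lemma greedy_local i : lp (greedy i).
Proof.
elim: i => [|j ih] /=; first exact: local_p0.
set kN := odflt _ _; have s0 := @posq_gt0 R kN.1.
apply: (patch_local (q := fun=> posq kN.1) _ _ _ (n := kN.2)) => //.
- by move=> r; exact: ltW.
- by move=> r; exact: integrand_fin.
- apply: measurable_and.
    by apply: good_measurable => // r; exact: ltW.
  apply: measurable_fun_ltr; last exact: mcst.
  by apply: mpsi; case: ih.
- by move=> r /andP[].
Qed.

Lemma greedy_homo r i j : (i <= j)%N -> psi (greedy i) r <= psi (greedy j) r.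
Proof.
elim: j => [|j ih]; first by rewrite leqn0 => /eqP ->.
rewrite leq_eqVlt => /predU1P[->//|]; rewrite ltnS => /ih /le_trans; apply.
rewrite [leRHS]/psi/=; set kN := odflt _ _.
by case: ifPn => // /andP[_] /ltW.
Qed.

Lemma psi_integrable p : ip p -> Int (psi p).
Proof.
move=> hp; apply: integrable_realB; last exact: profile_intb.
rewrite (_ : (fun r => _) = (fun r => t1 * p r + t2 * (X r * p r))); last first.
  by apply/funext => r; rewrite /tau; ring.
by apply: integrable_realD; apply: integrable_realZ; [exact: profile_int|exact: profile_intX].
Qed.

Lemma Rintegral_psi p : ip p -> \int[mu]_r psi p r = t1 * mass p + t2 * ex p - en p.
Proof.
move=> hp; have [mp p0' pf pi pX pb] := hp.
rewrite (_ : (fun r => _) = (fun r => (t1 * p r + t2 * (X r * p r)) - b p r)); last first.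
  by apply/funext => r; rewrite /psi /tau; ring.
have Z := integrable_realZ.
rewrite RintegralB//; last by apply: integrable_realD; exact: Z.
by rewrite RintegralD ?RintegralZl//; exact: Z.
Qed.

(* The integral of a supremum is the supremum of the integrals: a sequence of local
   perturbations, each switching to one positive rational constant where this is
   profitable, increases to the conjugate. *)
Lemma conjugate_integral_le A :
  (forall p, lp p -> t1 * mass p + t2 * ex p - en p <= A) ->
  mu.-integrable setT (fun r => conjugate beta r (t1 + t2 * X r)) /\
  (K mu beta X t1 t2 <= A%:E)%E.
Proof.
move=> hA.
have [fi fA] : mu.-integrable setT (fun r => conjugate beta r (t1 + t2 * X r)) /\
    (\int[mu]_r conjugate beta r (t1 + t2 * X r) <= A%:E)%E.
  apply: (@monotone_limit_integrable _ _ _ mu (fun i => psi (greedy i))).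
  - by move=> i; apply: psi_integrable; case: (greedy_local i).
  - exact: greedy_homo.
  - move=> r; apply/eqP; rewrite eq_le; apply/andP; split.
      rewrite conjugate_posq//; apply: ge_ereal_sup => _ [k _ <-].
      have s0 := @posq_gt0 R k.
      have sfin r' := integrand_fin hbeta r' s0.
      have [N hN] : exists N, good (fun=> posq k) N r.
        have := @good_cover (fun=> posq k) r.
        by move=> [N _ hN]; exists N; apply: hN => /=.
      pose i := pickle (k, N).
      apply: (@le_trans _ _ (psi (greedy i.+1) r)%:E); last first.
        by apply: ereal_sup_ubound; exists i.+1.
      rewrite -(fineK (sfin r)) -EFinB lee_fin /psi /=.
      rewrite /i pickleK/= hN/=; case: ifPn => [_|]; first by rewrite mulrC.
      by rewrite -leNgt /psi mulrC.
    apply: ge_ereal_sup => _ [i _ <-]; have [hi _] := greedy_local i.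
    apply: le_trans (fenchel_le _ _ _ (greedy i r)).
    by rewrite -(fineK (profile_fin hi r)) -EFinB lee_fin /psi mulrC.
  - by move=> i; have [hi _] := greedy_local i; rewrite Rintegral_psi// hA//; exact: greedy_local.
by rewrite /K integral_or_pinfty_integrable.
Qed.

Lemma young_integral p : ip p ->
  mu.-integrable setT (fun r => conjugate beta r (t1 + t2 * X r)) ->
  ((t1 * mass p + t2 * ex p - en p)%:E <= K mu beta X t1 t2)%E.
Proof.
move=> hp hc; rewrite /K integral_or_pinfty_integrable// -Rintegral_psi// -integral_real.
  apply: le_integral => //; first exact: psi_integrable.
  move=> r _; apply: le_trans (fenchel_le _ _ _ (p r)).
  by rewrite -(fineK (profile_fin hp r)) -EFinB lee_fin /psi mulrC.
exact: psi_integrable.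
Qed.

End interchange.

(** * The mass constraint *)

Hypothesis hmass : mass p0 = 1.

Lemma scaled_fin c : 0 < c -> forall r, beta r (c * p0 r) \is a fin_num.
Proof.
move=> c0 r; have := profile_ge0 hp0 r; rewrite le_eqVlt => /predU1P[p0E|pr0].
  by rewrite -p0E mulr0 p0E; exact: profile_fin.
by apply: (integrand_fin hbeta); rewrite mulr_gt0.
Qed.

(** A local substitute for [c * p0], with mass tending to [c]. *)
Definition scaled c n r := if good (fun r => c * p0 r) n r then c * p0 r else p0 r.

Let mp0 : measurable_fun setT p0. Proof. exact: profile_measurable. Qed.

Let mscale c : measurable_fun setT (fun r => c * p0 r).
Proof. exact: measurable_funM. Qed.

Let scale0 c : 0 < c -> forall r, 0 <= c * p0 r.
Proof. by move=> c0 r; exact: mulr_ge0 (ltW c0) (profile_ge0 hp0 r). Qed.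

Lemma scaled_local c n : 0 < c -> lp (scaled c n).
Proof.
move=> c0; apply: (patch_local (q := fun r => c * p0 r) _ _ _ (n := n)) => //.
- exact: scale0.
- exact: scaled_fin.
- exact: local_p0.
- by apply: good_measurable => //; exact: scale0.
Qed.

(** The difference from [p0] is [(c - 1) * p0] on the good sets and 0 elsewhere, so dominated
    convergence applies. *)
Lemma scaled_cvg c g : 0 < c -> Int (fun r => g r * p0 r) ->
  \int[mu]_r (g r * scaled c n r) @[n --> \oo] --> c * \int[mu]_r (g r * p0 r).
Proof.
move=> c0 gi; pose G := good (fun r => c * p0 r).
have mG n : measurable_fun setT (G n) by apply: good_measurable => //; exact: scale0.
have Ii n : Int (fun r => if G n r then g r * p0 r else 0).
  by apply: integrable_real_if => //; exact: integrable_real0.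
rewrite (_ : (fun n => _) = (fun n => \int[mu]_r (g r * p0 r) +
    (c - 1) * \int[mu]_r (if G n r then g r * p0 r else 0))); last first.
  apply/funext => n; rewrite -RintegralZl//; last exact: Ii.
  rewrite -RintegralD//; last exact/integrable_realZ/Ii.
  apply: eq_Rintegral => r _; rewrite /scaled -/(G n r); case: ifP => _; ring.
rewrite (_ : c * _ = \int[mu]_r (g r * p0 r) + (c - 1) * \int[mu]_r (g r * p0 r)); last by ring.
apply: cvgD; first exact: cvg_cst.
apply: cvgM; first exact: cvg_cst.
apply: cvg_Rintegral_if => // r.
by apply: good_cover.
Qed.

Lemma scaled_mass_cvg c : 0 < c -> mass (scaled c n) @[n --> \oo] --> c.
Proof.
have E (f : T -> R) : (fun r => 1 * f r) = f by apply/funext => r; rewrite mul1r.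
move=> c0; have := @scaled_cvg c (fun=> 1) c0.
rewrite E hmass mulr1 => /(_ (profile_int hp0)).
by under eq_fun do rewrite E.
Qed.

(** The scalings by 2 and by 1/2 supply masses on both sides of 1, as [multiplier_exists]
    requires. *)
Lemma mass_multiplier (h : (T -> R) -> R) :
  (forall p q t, lp p -> lp q -> 0 <= t <= 1 ->
    h (mixture t p q) <= t * h p + (1 - t) * h q) ->
  (forall p, lp p -> mass p = 1 -> 0 <= h p) ->
  exists th, forall p, lp p -> th * (mass p - 1) <= h p.
Proof.
move=> hh h0; apply: (multiplier_exists (D := lp)).
- move=> p q t lpp lpq t01; have [lm mE _ _] := mixture_local lpp lpq t01.
  exists (mixture t p q); split => //; last exact: hh.
  by rewrite mE; ring.
- have [n _ hn] : \forall n \near \oo, 1 < mass (scaled 2 n).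
    by apply: (cvgr_gt _ (scaled_mass_cvg _)); rewrite ?ltr1n.
  exists (scaled 2 n); first exact: scaled_local.
  by rewrite subr_gt0; apply: hn => /=.
- have [n _ hn] : \forall n \near \oo, mass (scaled 2^-1 n) < 1.
    by apply: (cvgr_lt _ (scaled_mass_cvg _)); rewrite ?invf_lt1// ltr1n.
  exists (scaled 2^-1 n); first by apply: scaled_local; rewrite invr_gt0.
  by rewrite subr_lt0; apply: hn => /=.
- by move=> p lpp /eqP; rewrite subr_eq0 => /eqP; exact: h0.
Qed.

Lemma inner_dual_attained t2 A :
  (forall p, lp p -> mass p = 1 -> t2 * ex p - en p <= A) ->
  exists t1, mu.-integrable setT (fun r => conjugate beta r (t1 + t2 * X r)) /\
    (K mu beta X t1 t2 <= (A + t1)%:E)%E.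
Proof.
move=> hA.
have [||t1 ht] := @mass_multiplier (fun p => en p - t2 * ex p + A).
- move=> p q t lpp lpq t01; have [_ _ -> +] := mixture_local lpp lpq t01; lra.
- by move=> p lpp mp; have := hA p lpp mp; lra.
exists t1; apply: conjugate_integral_le => p lpp.
by have := ht p lpp; lra.
Qed.

(* Otherwise a multiplier [th] of the mass constraint bounds [int (X - th) p] below by
   [w - th] for all [p]: letting [p] tend to 0 gives [w <= th], and enlarging [p] on
   [X < th] gives [th <= X] almost everywhere. *)
Lemma expectation_near_ess_inf w : (ess_inf mu (EFin \o X) < w%:E)%E ->
  exists p, [/\ lp p, mass p = 1 & ex p < w].
Proof.
move=> mw; apply: contrapT => hno.
have hw p : lp p -> mass p = 1 -> w <= ex p.
  by move=> lpp mp; rewrite leNgt; apply/negP => exw; apply: hno; exists p.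
have [||th ht] := @mass_multiplier (fun p => ex p - w).
- by move=> p q t lpp lpq t01; have [_ _ -> _] := mixture_local lpp lpq t01; lra.
- by move=> p lpp mp; rewrite subr_ge0 hw.
have {}ht p : lp p -> w - th <= \int[mu]_r ((X r - th) * p r).
  move=> lpp; have [hp _] := lpp; have [_ _ _ pi pX _] := hp.
  rewrite (_ : (fun r => _) = (fun r => X r * p r - th * p r)); last first.
    by apply/funext => r; ring.
  rewrite RintegralB ?RintegralZl//; last exact: integrable_realZ.
  by have := ht p lpp; lra.
have ip0 : Int (fun r => (X r - th) * p0 r).
  rewrite (_ : (fun r => _) = (fun r => X r * p0 r - th * p0 r)); last first.
    by apply/funext => r; ring.
  by have [_ _ _ pi pX _] := hp0; apply: integrable_realB => //; exact: integrable_realZ.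
(* Scaling [p0] by small [c] makes the right side of [ht] tend to 0; the factor [(w - th) / (2 * I)]
   brings it down to half of [w - th]. *)
have wth : w <= th.
  rewrite -subr_le0 leNgt; apply/negP => wt.
  have hc c : 0 < c -> w - th <= c * \int[mu]_r ((X r - th) * p0 r).
    move=> c0; rewrite -(cvg_lim _ (scaled_cvg c0 ip0))//.
    apply: limr_ge; first by apply/cvg_ex; eexists; exact: (scaled_cvg c0 ip0).
    by apply: nearW => n; apply: ht; exact: scaled_local.
  move: hc; set I := \int[mu]_r _ => hc.
  have I0 : 0 < I by have := hc 1 ltr01; lra.
  have := hc ((w - th) / (2 * I)) _; rewrite divr_gt0 ?mulr_gt0// => /(_ isT).
  have -> : (w - th) / (2 * I) * I = (w - th) / 2 by field; rewrite gt_eqF.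
  by lra.
pose Y r := if X r < th then th - X r else 0.
have mXth : measurable_fun setT (fun r => X r < th) by exact: measurable_fun_ltr.
have mY : measurable_fun setT Y.
  by apply: measurable_fun_ifT => //; exact: measurable_funB.
(* Raising [p0] to the constant [s] on part of [X < th] lowers the integral by [s] times that of
   [th - X]. The bound [ht] therefore caps [s] times the integral of [Y] by [C], which does not
   depend on [s]. The absolute value absorbs the part of [p0] that is replaced. *)
pose C := \int[mu]_r `|(X r - th) * p0 r| + \int[mu]_r ((X r - th) * p0 r) - (w - th).
have hY s : 0 < s -> (\int[mu]_r (Y r)%:E <= (C / s)%:E)%E.
  move=> s0; pose a n r := good (fun=> s) n r && (X r < th).
  have ma n : measurable_fun setT (a n).
    apply: measurable_and => //; apply: good_measurable => // r; exact: ltW.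
  pose u n r := if a n r then th - X r else 0.
  have ui n : Int (u n).
    apply: (integrable_real_bounded (M := `|th| + n%:R)) => //.
    - by apply: (core_sub_finite (n := n)) => // r /andP[/and3P[]].
    - exact: measurable_funB.
    - move=> r /andP[/and3P[cr _ _] _]; have [Xn _ _] := core_bound hcore cr.
      by rewrite (le_trans (ler_normB _ _))// lerD2l.
  apply: (@monotone_limit_integrable _ _ _ mu u (EFin \o Y) (C / s) _ _ _ _).2 => //.
  - move=> r i j ij; rewrite /u /a; case: ltP => [Xr|]; last by rewrite !andbF.
    rewrite !andbT; case: ifPn => [/(good_homo ij) ->//|_].
    by case: ifP => // _; rewrite subr_ge0 ltW.
  - move=> r; apply/eqP; rewrite eq_le; apply/andP; split.
      have [n _ hn] : \forall n \near \oo, good (fun=> s) n r by exact: good_cover.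
      apply: ereal_sup_ubound; exists n => //.
      by rewrite /u /a /Y hn//=.
    apply: ge_ereal_sup => _ [n _ <-]; rewrite lee_fin /u /a /Y.
    case: ltP => [Xr|]; last by rewrite andbF.
    by rewrite andbT; case: ifP => // _; rewrite subr_ge0 ltW.
  - move=> n; rewrite ler_pdivlMr// mulrC -RintegralZl//; last exact: ui.
    pose p r := if a n r then s else p0 r.
    have lpp : lp p.
      apply: (patch_local (q := fun=> s) _ _ _ (n := n)) => //.
      + by move=> r; exact: ltW.
      + by move=> r; exact: integrand_fin.
      + exact: local_p0.
      + by move=> r /andP[].
    have ipp : Int (fun r => (X r - th) * p r).
      rewrite (_ : (fun r => _) = (fun r => X r * p r - th * p r)); last first.
        by apply/funext => r; ring.
      by have [[_ _ _ pi pX _] _] := lpp; apply: integrable_realB => //; exact: integrable_realZ.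
    have hle : \int[mu]_r (s * u n r) <= \int[mu]_r ((`|(X r - th) * p0 r| + (X r - th) * p0 r)
        - (X r - th) * p r).
      apply: le_Rintegral_setT.
      + exact/integrable_realZ/ui.
      + apply: integrable_realB => //; apply: integrable_realD => //.
        exact: integrable_real_norm.
      + move=> r; rewrite /u /p; have := ler_norm (- ((X r - th) * p0 r)).
        have := normr_ge0 ((X r - th) * p0 r).
        rewrite normrN; case: ifP => _; lra.
    apply: le_trans hle _; rewrite RintegralB//; last first.
      by apply: integrable_realD => //; exact: integrable_real_norm.
    rewrite RintegralD//; last exact: integrable_real_norm.
    by rewrite /C lerD2l lerN2; exact: ht.
have Y0 r : 0 <= Y r by rewrite /Y; case: ltP => // h; rewrite subr_ge0 ltW.
have intY : (\int[mu]_r (Y r)%:E = 0)%E.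
  apply/eqP; rewrite eq_le; apply/andP; split; last first.
    by apply: integral_ge0 => r _; rewrite lee_fin.
  apply/lee_addgt0Pr => e e0; rewrite add0e.
  have C0 : 0 <= C / 1.
    by rewrite -lee_fin (le_trans _ (hY 1 ltr01))//; apply: integral_ge0 => r _; rewrite lee_fin.
  (* With this [s], [C / s] is at most [e]; adding 1 keeps [s] positive when [C = 0]. *)
  have ce0 : 0 < (C + 1) / e by rewrite divr_gt0//; lra.
  apply: le_trans (hY _ ce0) _; rewrite lee_fin invf_div mulrA ler_pdivrMr; nra.
have aeX : \forall r \ae mu, (th%:E <= (EFin \o X) r)%E.
  have mEY : measurable_fun setT (EFin \o Y) by exact/measurable_EFinP.
  have absY : (\int[mu]_r `|(EFin \o Y) r| = 0)%E.
    by rewrite -intY; apply: eq_integral => r _ /=; rewrite ger0_norm.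
  have := (ae_eq_integral_abs mu measurableT mEY).1 absY.
  apply: filterS => r /(_ I) /=; rewrite /Y; case: ltP => // h [] hh.
  by rewrite lee_fin; lra.
have := mw; rewrite ltNge => /negP; apply.
by have /ess_infP := aeX; apply: le_trans; rewrite lee_fin.
Qed.

(** * Strong duality *)

Hypothesis hen : en p0 = 0.
Hypothesis hm : (ess_inf mu (EFin \o X) < (ex p0)%:E)%E.
Hypothesis hH : forall p, is_density mu p -> (0 <= H mu beta p)%E.

Lemma profile_density p : ip p -> mass p = 1 -> is_density mu p.
Proof.
by move=> [mp p0' _ pi _ _] mE; split => //; rewrite integral_real// mE.
Qed.

Lemma H_profile p : ip p -> H mu beta p = (en p)%:E.
Proof.
move=> [mp p0' pf _ _ pb]; rewrite /H.
have -> : (fun r => beta r (p r)) = (fun r => (b p r)%:E).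
  by apply/funext => r; rewrite fineK.
by rewrite integral_or_pinfty_integrable// integral_real.
Qed.

Lemma has_integral_real f : Int f -> has_integral mu (EFin \o f) (\int[mu]_r f r)%:E.
Proof.
move=> fi; split; last by rewrite integral_real.
by left; exact: integral_funepos_lt_pinfty.
Qed.

Lemma has_integral_fin f a : measurable_fun setT f ->
  has_integral mu (EFin \o f) a%:E -> Int f /\ \int[mu]_r f r = a.
Proof.
move=> mf [def fE]; have fi : Int f.
  apply: integral_or_pinfty_lty; first exact/measurable_EFinP.
    by rewrite /integral_or_pinfty asboolT// fE ltry.
  by rewrite /integral_or_pinfty asboolT// fE ltNyr.
by split => //; rewrite /Rintegral fE.
Qed.

(** Finite energy makes [beta r (p r)] finite almost everywhere; on the exceptional null set [p] is
    replaced by 1, where [beta r] is always finite. *)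
Lemma density_profile p : is_density mu p -> (H mu beta p < +oo)%E ->
  Int (fun r => X r * p r) ->
  exists p', [/\ ip p', ae_eq mu setT p p', mass p' = 1,
    ex p' = ex p & H mu beta p = (en p')%:E].
Proof.
move=> dp hfin iX; have [mp pp0 pm] := dp.
have mb : measurable_fun setT (fun r => beta r (p r)) by exact: measurable_beta.
have ib : mu.-integrable setT (fun r => beta r (p r)).
  by apply: integral_or_pinfty_lty => //; exact: lt_le_trans (hH dp).
have ipr : Int p.
  apply/integrableP; split; first exact/measurable_EFinP.
  under eq_integral do rewrite gee0_abs ?lee_fin//.
  by rewrite pm ltry.
pose p' r := if beta r (p r) \is a fin_num then p r else 1.
have ae : ae_eq mu setT p p'.
  have := integrable_ae measurableT ib.
  by apply: filterS => r /(_ I) h _; rewrite /p' h.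
have mfin : measurable_fun setT (fun r => beta r (p r) \is a fin_num).
  apply: (measurable_fun_bool true).
  exact: emeasurable_fin_num.
have mp' : measurable_fun setT p' by exact: measurable_fun_ifT.
have pp0' r : 0 <= p' r by rewrite /p'; case: ifP.
have pf' r : beta r (p' r) \is a fin_num.
  by rewrite /p'; case: ifP => // _; exact: (integrand_fin hbeta).
have [i1 e1] := ae_eq_integrable_real ipr mp' ae.
have aeX : ae_eq mu setT (fun r => X r * p r) (fun r => X r * p' r).
  by apply: filterS ae => r h rT; rewrite h.
have [i2 e2] := ae_eq_integrable_real iX (measurable_funM hX mp') aeX.
have mb' : measurable_fun setT (fun r => beta r (p' r)) by exact: measurable_beta.
have aeb : ae_eq mu setT (fun r => beta r (p r)) (fun r => beta r (p' r)).
  by apply: filterS ae => r h rT; rewrite h.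
have [i3 e3] := ae_eq_integrable ib mb' aeb.
have ib' := integrable_real_fineK pf' i3.
have hp' : ip p' by [].
exists p'; split => //; first by rewrite e1 /Rintegral pm.
by rewrite -(H_profile hp') /H !integral_or_pinfty_integrable.
Qed.

(** For profiles that are not local perturbations, tangents give no global minorant. Convexity
    bounds the positive part of the energy, so its integral is defined, and [hH] excludes the value
    [-oo]. *)
Lemma mixture_density t p q : ip p -> ip q -> 0 <= t <= 1 -> mass p = 1 -> mass q = 1 ->
  [/\ ip (mixture t p q), mass (mixture t p q) = 1,
    ex (mixture t p q) = t * ex p + (1 - t) * ex q &
    en (mixture t p q) <= t * en p + (1 - t) * en q].
Proof.
move=> hp hq t01 mp1 mq1; have [t0 t1] := andP t01.
have mm : measurable_fun setT (mixture t p q).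
  by apply: measurable_funD; apply: measurable_funM => //; exact: profile_measurable.
have mix0 r : 0 <= mixture t p q r.
  by rewrite addr_ge0// mulr_ge0// ?(profile_ge0 hp) ?(profile_ge0 hq)//; lra.
have mb : measurable_fun setT (b (mixture t p q)).
  by apply: measurableT_comp => //; exact: measurable_beta.
pose h r : R := t * b p r + (1 - t) * b q r.
have ih : Int h.
  by apply: integrable_realD; apply: integrable_realZ; exact: profile_intb.
have bE : (fun r => beta r (mixture t p q r)) = EFin \o b (mixture t p q).
  by apply/funext => r /=; rewrite fineK//; exact: (mixture_le r hp hq t01).1.
have dm : is_density mu (mixture t p q).
  split => //; rewrite integral_real; last first.
    by apply: integrable_realD; apply: integrable_realZ; exact: profile_int.
  rewrite RintegralD ?RintegralZl ?mp1 ?mq1//; try exact: profile_int; last 2 first.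
  - by apply: integrable_realZ; exact: profile_int.
  - by apply: integrable_realZ; exact: profile_int.
  by congr EFin; ring.
have := hH dm; rewrite /H bE => H0.
have ib : Int (b (mixture t p q)).
  apply: integral_or_pinfty_lty; first exact/measurable_EFinP.
    rewrite /integral_or_pinfty; have def : (\int[mu]_r ((EFin \o b (mixture t p q))^\+ r) < +oo)%E.
      have : (\int[mu]_r ((EFin \o h)^\+ r) < +oo)%E by exact: integral_funepos_lt_pinfty.
      apply: le_lt_trans.
      apply: ge0_le_integral => //.
      - by apply: measurable_funepos; exact/measurable_EFinP.
      - by apply: measurable_funepos; exact: measurable_int ih.
      - move=> r _; rewrite !funeposE ge_max !le_max lexx orbT andbT.
        by rewrite lee_fin (mixture_le r hp hq t01).2.
    rewrite asboolT; last by left.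
    rewrite integralE; apply: le_lt_trans def.
    rewrite -[leRHS]sube0; apply: leeB => //; exact: integral_ge0.
  exact: lt_le_trans H0.
have [//|hip -> -> ?] := mixture_profile hp hq t01 ib.
by split => //; rewrite mp1 mq1; ring.
Qed.

(** Mixing with [p0], which has energy 0, raises the expectation from [x] to [y] and multiplies the
    energy bound by a weight at most 1. *)
Lemma F_nonincreasing (x y : R) : x < y -> y < ex p0 -> (F mu beta X y <= F mu beta X x)%E.
Proof.
move=> xy yb; apply: le_ereal_inf_tmp => _ [p [dp hx] <-].
have [Hy|Hfin] := leP +oo%E (H mu beta p); first by rewrite (le_trans _ Hy)// leey.
have [mp _ _] := dp.
have [iX eX] := has_integral_fin (measurable_funM hX mp) hx.
have [p' [hp' _ m' e' ->]] := density_profile dp Hfin iX.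
pose t := (ex p0 - y) / (ex p0 - x).
have xb : 0 < ex p0 - x by lra.
have t01 : 0 <= t <= 1.
  apply/andP; split; first by rewrite divr_ge0//; lra.
  by rewrite ler_pdivrMr//; lra.
have [hm' mm em nm] := mixture_density hp' hp0 t01 m' hmass.
have H0' : 0 <= en p'.
  by rewrite -lee_fin -H_profile// hH//; exact: profile_density.
apply: (@le_trans _ _ (H mu beta (mixture t p' p0))).
  apply: ereal_inf_lbound; exists (mixture t p' p0) => //; split.
    exact: profile_density.
  have -> : y = ex (mixture t p' p0).
    by rewrite em e' eX /t; field; rewrite gt_eqF.
  exact: has_integral_real (profile_intX hm').
rewrite H_profile// lee_fin (le_trans nm)// hen mulr0 addr0.
by case/andP: t01 => _ t1; rewrite ler_piMl.
Qed.

Lemma lt_k_max (k : \bar R) : (k < k_max mu beta X)%E ->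
  exists x : R, [/\ (ess_inf mu (EFin \o X) < x%:E)%E, x < ex p0 & (k < F mu beta X x)%E].
Proof.
move=> kk; apply: contrapT => hno.
have hF x : (ess_inf mu (EFin \o X) < x%:E)%E -> x < ex p0 -> (F mu beta X x <= k)%E.
  by move=> mx xb; rewrite leNgt; apply/negP => kF; apply: hno; exists x.
move: kk; rewrite ltNge => /negP; apply; rewrite /k_max.
case E : (ess_inf mu (EFin \o X)) hm => [m| |]//= hm'; last first.
  (* After the reflection [x] to [- x], the maximum keeps the argument of [F] below [ex p0], where
     [F] is monotone, and does not change the limit. *)
  rewrite (_ : lim _ = ereal_sup (range (fun x => F mu beta X (- Num.max x (1 - ex p0))))).
    apply: ge_ereal_sup => _ [x _ <-]; apply: hF; first by rewrite E ltNyr.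
    have : 1 - ex p0 <= Num.max x (1 - ex p0) by rewrite le_max lexx orbT.
    lra.
  apply: cvg_lim => //; apply/cvgNy_compNP.
  have : F mu beta X (- Num.max x (1 - ex p0)) @[x --> +oo] -->
      ereal_sup (range (fun x => F mu beta X (- Num.max x (1 - ex p0)))).
    apply: nondecreasing_cvge => x y xy.
    have : Num.max x (1 - ex p0) <= Num.max y (1 - ex p0).
      by rewrite ge_max !le_max xy lexx orbT.
    rewrite le_eqVlt => /predU1P[-> //|lt]; apply: F_nonincreasing; first by rewrite ltrN2.
    have : 1 - ex p0 <= Num.max x (1 - ex p0) by rewrite le_max lexx orbT.
    lra.
  apply: cvg_trans; apply: near_eq_cvg; near=> x.
  by rewrite /= max_l//; near: x; exact: nbhs_pinfty_ge.
have mb : m < ex p0 by rewrite -lte_fin.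
have := @nonincreasing_at_right_cvge _ (F mu beta X) m (BLeft (ex p0)).
rewrite bnd_simp mb => /(_ isT) hc.
rewrite (cvg_lim _ (hc _))//.
- apply: ge_ereal_sup => _ [x /= + <-]; rewrite in_itv/= => /andP[mx xb].
  by apply: hF => //; rewrite E lte_fin.
- move=> x y; rewrite !in_itv/= => /andP[mx xb] /andP[my yb].
  rewrite le_eqVlt => /predU1P[-> //|xy]; exact: F_nonincreasing.
Unshelve. all: by end_near. Qed.

(** Here [k < k_max] takes effect: expectations at energy level [k] stay above a point [x] that is
    itself above the essential infimum. Otherwise mixing with [p0] would reach [x] with energy at
    most [k]. *)
Lemma mixture_p0_below (x k : R) p : lp p -> mass p = 1 -> en p <= k -> 0 <= k ->
  (k%:E < F mu beta X x)%E -> x < ex p0 -> x <= ex p.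
Proof.
move=> [hp _] mp1 pk k0 kF xb; rewrite leNgt; apply/negP => px.
pose t := (ex p0 - x) / (ex p0 - ex p).
have pb : 0 < ex p0 - ex p by lra.
have t01 : 0 <= t <= 1.
  apply/andP; split; first by rewrite divr_ge0//; lra.
  by rewrite ler_pdivrMr//; lra.
have [hm' mm em nm] := mixture_density hp hp0 t01 mp1 hmass.
move: kF; rewrite ltNge => /negP; apply.
apply: (@le_trans _ _ (H mu beta (mixture t p p0))).
  apply: ereal_inf_lbound; exists (mixture t p p0) => //; split.
    exact: profile_density.
  have -> : x = ex (mixture t p p0) by rewrite em /t; field; rewrite gt_eqF.
  exact: has_integral_real (profile_intX hm').
rewrite H_profile// lee_fin (le_trans nm)// hen mulr0 addr0.
case/andP: t01 => t0 t1; apply: (@le_trans _ _ (t * k)); first exact: ler_wpM2l.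
by rewrite ler_piMl.
Qed.

Lemma energy_slack (k : R) p p' : lp p -> lp p' -> mass p = 1 -> mass p' = 1 ->
  en p < k -> ex p' < ex p -> exists q, [/\ lp q, mass q = 1, en q <= k & ex q < ex p].
Proof.
move=> lpp lpp' mp mp' pk ep.
pose dd : R := k - en p; pose c : R := `|en p' - k|.
(* The step [1 - t] is so small that the possible excess [c] of [p'] uses up less than the slack
   [dd]: the mixture has energy at most [k - dd / (dd + c + 1)]. *)
pose t : R := (c + 1) / (dd + c + 1).
have d0 : 0 < dd by rewrite /dd; lra.
have c0 : 0 <= c by exact: normr_ge0.
have s0 : 0 < dd + c + 1 by lra.
have t1 : t < 1 by rewrite /t ltr_pdivrMr//; lra.
have t0 : 0 <= t by rewrite /t divr_ge0//; lra.
have t01 : 0 <= t <= 1 by rewrite t0 ltW.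
have [lm mm em nm] := mixture_local lpp lpp' t01.
exists (mixture t p p'); split => //.
- by rewrite mm mp mp'; ring.
- apply: le_trans nm _.
  have e1 : en p' <= k + c by have := ler_norm (en p' - k); rewrite -/c; lra.
  apply: (@le_trans _ _ (t * en p + (1 - t) * (k + c))).
    by rewrite lerD2l; apply: ler_wpM2l => //; lra.
  have -> : en p = k - dd by rewrite /dd; ring.
  have -> : t * (k - dd) + (1 - t) * (k + c) = k - dd / (dd + c + 1).
    by rewrite /t; field; rewrite gt_eqF.
  by rewrite gerBl divr_ge0//; lra.
- rewrite em.
  have : 0 < (1 - t) * (ex p - ex p') by rewrite mulr_gt0//; lra.
  lra.
Qed.

(* [v] is the primal value; a profile of expectation [v] has energy at least [k], which
   yields the multiplier of the energy constraint and then that of the mass constraint. *)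
Lemma dual_attained (k : R) : 0 < k -> (k%:E < k_max mu beta X)%E ->
  exists v t1 t2 : R, [/\ t2 < 0, v < ex p0,
    mu.-integrable setT (fun r => conjugate beta r (t1 + t2 * X r)),
    (K mu beta X t1 t2 <= (t1 + t2 * v - k)%:E)%E &
    forall e : R, 0 < e -> exists p, [/\ lp p, mass p = 1, en p <= k & ex p < v + e]].
Proof.
move=> k0 /lt_k_max[x [mx xb kF]].
pose A := [set ex p | p in [set p | [/\ lp p, mass p = 1 & en p <= k]]].
have A0 : A !=set0.
  by exists (ex p0), p0 => //; split; [exact: local_p0|by []|rewrite hen ltW].
have Alb : lbound A x.
  by move=> _ [p [lpp mp pk] <-]; apply: mixture_p0_below lpp mp pk _ kF xb; exact: ltW.
have hinf : has_inf A by split => //; exists x.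
pose v := inf A.
have xv : x <= v by exact: lb_le_inf.
have mv : (ess_inf mu (EFin \o X) < v%:E)%E by apply: lt_le_trans mx _; rewrite lee_fin.
have vle p : lp p -> mass p = 1 -> en p <= k -> v <= ex p.
  by move=> lpp mp pk; apply: ge_inf; [exists x|exists p].
have vb : v < ex p0.
  have [p' [lpp' mp' ep']] := expectation_near_ess_inf hm.
  have [|q [lpq mq qk eq]] := energy_slack (k := k) local_p0 lpp' hmass mp' _ ep'.
    by rewrite hen.
  by apply: le_lt_trans eq; exact: vle.
(* Since [v] exceeds the essential infimum, the constraint [ex p = v] has profiles on both sides:
   [p'] below and [p0] above. *)
have [p' [lpp' mp' ep']] := expectation_near_ess_inf mv.
have [||||th ht] := @multiplier_exists R (T -> R) [set p | lp p /\ mass p = 1]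
    (fun p => ex p - v) (fun p => en p - k).
- move=> p q t [lpp mp] [lpq mq] t01; have [lm mm em nm] := mixture_local lpp lpq t01.
  exists (mixture t p q); split; first by split => //; rewrite mm mp mq; ring.
    by rewrite em; ring.
  lra.
- by exists p0; [split => //; exact: local_p0|rewrite subr_gt0].
- by exists p' => //; rewrite subr_lt0.
- move=> p [lpp mp] /eqP; rewrite subr_eq0 => /eqP pv.
  rewrite leNgt; apply/negP => pk.
  have pk' : en p < k by lra.
  have epp : ex p' < ex p by rewrite pv.
  have [q [lpq mq qk eq]] := energy_slack lpp lpp' mp mp' pk' epp.
  by have := vle q lpq mq qk; lra.
have [|t1 [ci cK]] := @inner_dual_attained th (th * v - k).
  by move=> p lpp mp; have := ht p (conj lpp mp); lra.
(* Tested with [p0], of energy 0 and expectation above [v], the multiplier inequality gives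
   [th * (ex p0 - v) <= - k]. *)
have th0 : th < 0.
  have := ht p0 (conj local_p0 hmass); rewrite hen => h.
  have : th * (ex p0 - v) < 0 by lra.
  by rewrite pmulr_llt0// subr_gt0.
exists v, t1, th; split => //.
  by rewrite (_ : t1 + th * v - k = th * v - k + t1)//; ring.
move=> e e0; have [_ [p [lpp mp pk] <-] pe] := inf_adherent e0 hinf.
by exists p.
Qed.

(** * Directional derivatives of K *)

Local Notation tau t r := (t.1 + t.2 * X r).
Local Notation cj t := (fun r => conjugate beta r (tau t r)).
Local Notation cr t := (fun r => fine (conjugate beta r (tau t r))).
Local Notation sl t := (fun r => conjugate_slope beta r (tau t r)).
Local Notation cint t := (mu.-integrable setT (cj t)).
Local Notation KR t := (\int[mu]_r fine (conjugate beta r (tau t r))).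
Implicit Types t u : R * R.

Lemma tau_measurable t : measurable_fun setT (fun r => tau t r).
Proof. by apply: measurable_funD => //; exact: measurable_funM. Qed.

Lemma cj_measurable t : measurable_fun setT (cj t).
Proof. by apply: measurable_conjugate => //; exact: tau_measurable. Qed.

Lemma cr_measurable t : measurable_fun setT (cr t).
Proof. by apply: measurableT_comp => //; exact: cj_measurable. Qed.

Lemma sl_measurable t : measurable_fun setT (sl t).
Proof. by apply: measurable_conjugate_slope => //; exact: tau_measurable. Qed.

Lemma young_p0 t r : (((tau t r) * p0 r - b p0 r)%:E <= conjugate beta r (tau t r))%E.
Proof.
apply: le_trans (fenchel_le _ _ _ (p0 r)).
by rewrite -(fineK (profile_fin hp0 r)) -EFinB lee_fin mulrC.
Qed.

(** Young's inequality with [p0] provides an integrable minorant, so [K] is never [-oo] and an upper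
    bound suffices for integrability. *)
Lemma dom_K_integrable t : dom_K mu beta X t <-> cint t.
Proof.
split; last first.
  move=> ct; rewrite /dom_K/= /K integral_or_pinfty_integrable//.
  by have := integrable_fin_num measurableT ct; rewrite fin_numElt => /andP[].
move=> dt; apply: integral_or_pinfty_lty => //; first exact: cj_measurable.
rewrite /integral_or_pinfty; case: asboolP => // def.
have ipsi := psi_integrable t.1 t.2 hp0.
have neg : (\int[mu]_r ((cj t)^\- r) < +oo)%E.
  have : (\int[mu]_r ((EFin \o (fun r => tau t r * p0 r - b p0 r)%R)^\- r) < +oo)%E.
    exact: integral_funeneg_lt_pinfty.
  apply: le_lt_trans; apply: ge0_le_integral => //.
  - apply: measurable_funeneg; exact: cj_measurable.
  - by apply: measurable_funeneg; exact: measurable_int ipsi.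
  - move=> r _; rewrite !funenegE ge_max !le_max lexx orbT andbT.
    by rewrite leeN2 young_p0.
rewrite integralE.
have p0' : (0 <= \int[mu]_r (cj t)^\+ r)%E by exact: integral_ge0.
have n0' : (0 <= \int[mu]_r (cj t)^\- r)%E by exact: integral_ge0.
move: neg p0' n0'.
by case: (\int[mu]_r (cj t)^\+ r)%E => [x| |]; case: (\int[mu]_r (cj t)^\- r)%E => [y| |] //;
  rewrite -EFinB ltNyr.
Qed.

Lemma cint_fin t : cint t -> \forall r \ae mu, conjugate beta r (tau t r) \is a fin_num.
Proof. by move=> /(integrable_ae measurableT); apply: filterS => r /(_ I). Qed.

Lemma cint_real t : cint t -> Int (cr t) /\ K mu beta X t.1 t.2 = (KR t)%:E.
Proof.
move=> ct.
have mc : measurable_fun setT (EFin \o cr t) by apply/measurable_EFinP; exact: cr_measurable.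
have ae : ae_eq mu setT (cj t) (EFin \o cr t).
  by apply: filterS (cint_fin ct) => r h _ /=; rewrite fineK.
have [ic eq] := ae_eq_integrable ct mc ae; split => //.
by rewrite /K integral_or_pinfty_integrable// -integral_real.
Qed.

Lemma cint_le t g : measurable_fun setT g ->
  (forall r, (cj t r <= g r)%E) -> mu.-integrable setT g -> cint t.
Proof.
move=> mg cg ig; have ipsi := psi_integrable t.1 t.2 hp0.
pose h r := ((tau t r) * p0 r - b p0 r)%R.
have ib : mu.-integrable setT (fun r => `|g r| + `|h r|%:E)%E.
  apply: integrableD => //; first exact: integrable_abse.
  exact: (integrable_real_norm ipsi).
apply: (le_integrable measurableT _ _ ib); first exact: cj_measurable.
move=> r _; have := cg r; have := young_p0 t r; rewrite -/(h r).
rewrite (gee0_abs (_ : 0 <= `|g r| + _)%E); last by rewrite adde_ge0// lee_fin.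
case: (g r) => [x| |]; case: (conjugate _ _ _) => [y| |] //=; rewrite ?leey//.
rewrite -EFinD !lee_fin => h1 h2.
have := ler_norm x; have := ler_norm (- h r); rewrite normrN => h3 h4.
have := normr_ge0 x; have := normr_ge0 (h r) => h5 h6.
by rewrite ler_norml; apply/andP; split; lra.
Qed.

Lemma segment_cint t u e : cint t -> cint u -> 0 <= e <= 1 ->
  cint (t.1 + e * (u.1 - t.1), t.2 + e * (u.2 - t.2)).
Proof.
move=> ct cu /andP[e0 e1].
have ct' : mu.-integrable setT (fun r => (1 - e)%:E * cj t r)%E by exact: integrableZl.
have cu' : mu.-integrable setT (fun r => e%:E * cj u r)%E by exact: integrableZl.
have ig := integrableD measurableT ct' cu'.
(* Conjugates may be infinite on a null set and [0 * +oo] is 0, so the pointwise bound needs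
   positive weights at both ends. *)
have [->|en0] := eqVneq e 0.
  by rewrite !mul0r !addr0; case: t ct {ct' ig} => t1 t2.
have [->|en1] := eqVneq e 1.
  by rewrite !mul1r ![_ + (_ - _)]addrC !subrK; case: u cu {cu' ig} => u1 u2.
apply: cint_le (ig); first exact: measurable_int ig.
have e0' : 0 < e by rewrite lt_neqAle eq_sym en0.
have e1' : 0 < 1 - e by rewrite subr_gt0 lt_neqAle en1.
move=> r /=.
have := conjugate_gtNy hbeta r (tau u r); have := conjugate_gtNy hbeta r (tau t r).
case Et : (conjugate beta r (tau t r)) => [x| |]// _; last first.
  case: (conjugate beta r (tau u r)) => [y| |]// _.
    by rewrite gt0_muley ?lte_fin// -EFinM addye// leey.
  by rewrite !gt0_muley ?lte_fin// leey.
case Eu : (conjugate beta r (tau u r)) => [y| |]// _; last first.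
  by rewrite gt0_muley ?lte_fin// -EFinM addey// leey.
have := @conjugate_convex _ _ _ beta hbeta r (tau t r) (tau u r) x y (1 - e).
rewrite Et Eu => /(_ ltac:(apply/andP; split; lra) (lexx _) (lexx _)).
rewrite -!EFinM -EFinD.
rewrite (_ : _ + (1 - (1 - e)) * _ = t.1 + e * (u.1 - t.1) + (t.2 + e * (u.2 - t.2)) * X r).
  by rewrite (_ : 1 - (1 - e) = e)//; ring.
by ring.
Qed.

Lemma cint_shift t (e : R) : 0 <= e -> cint t -> cint (t.1 - e, t.2).
Proof.
move=> e0 ct; apply: cint_le (ct) => [|r]; first exact: cj_measurable.
by apply: conjugate_homo => //=; rewrite lerD2r gerBl.
Qed.

(* The integral is the left derivative of [K] in its first argument, and [t.1] minimises
   [K x t.2 - x]. *)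
Lemma slope_mass_le1 t : cint t -> (forall x, cint (x, t.2) -> KR t - t.1 <= KR (x, t.2) - x) ->
  mu.-integrable setT (sl t) /\ (\int[mu]_r sl t r <= 1)%E.
Proof.
move=> ct hmin; have [ict _] := cint_real ct.
pose e n : R := n.+1%:R^-1.
pose te n : R * R := (t.1 - e n, t.2).
have e0 n : 0 < e n by rewrite invr_gt0.
have ce n : cint (te n) by apply: cint_shift => //; exact: ltW.
pose fin r := conjugate beta r (tau t r) \is a fin_num.
have mfin : measurable_fun setT fin.
  apply: (measurable_fun_bool true); apply: emeasurable_fin_num => //; exact: cj_measurable.
(* The slope at [t] may still be infinite at this stage, but strictly to the left it is finite
   wherever the conjugate at [t] is. Hence [u n] is real, increases to the slope at [t], and lies
   below the difference quotient [v n]. *)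
pose u n r := if fin r then fine (conjugate_slope beta r (tau (te n) r)) else 0.
pose v n r := if fin r then (e n)^-1 * (cr t r - cr (te n) r) else 0.
have iv n : Int (v n).
  apply: integrable_real_if => //; last exact: integrable_real0.
  apply: integrable_realZ; apply: integrable_realB => //.
  by have [] := cint_real (ce n).
have v1 n : \int[mu]_r v n r <= 1.
  have [i1 _] := cint_real (ce n).
  have -> : \int[mu]_r v n r = (e n)^-1 * (KR t - KR (te n)).
    rewrite -RintegralB// -RintegralZl//; last exact: integrable_realB.
    apply: (ae_eq_integrable_real _ _ _).2.
    - apply: integrable_realZ; exact: integrable_realB.
    - exact: integrable_real_measurable (iv n).
    - by apply: filterS (cint_fin ct) => r h _; rewrite /v /fin h.
  rewrite ler_pdivrMl// mulr1; have := hmin _ (ce n) => /=; lra.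
have sfin n r : fin r -> (conjugate_slope beta r (tau (te n) r) < +oo)%E.
  move=> fr; have := @conjugate_slope_below _ _ _ beta hbeta r (tau t r) (e n).
  rewrite (_ : tau t r - e n = tau (te n) r); last by rewrite /=; ring.
  by apply => //; move: fr; rewrite /fin fin_numElt => /andP[].
have uv n r : 0 <= u n r <= v n r.
  rewrite /u /v; case: ifPn => fr; last by rewrite lexx.
  have [s s0 hs] := conjugate_slope_finP (sfin n r fr).
  rewrite hs/= s0/= ler_pdivlMl//.
  have := conjugate_subgradient hbeta (tau t r) hs.
  have f1 : conjugate beta r (tau (te n) r) \is a fin_num.
    by apply: conjugate_fin => //; exact: sfin.
  rewrite -(fineK f1) -[leRHS](fineK fr) -EFinD lee_fin /=.
  rewrite (_ : tau t r - (t.1 - e n + t.2 * X r) = e n); last by ring.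
  lra.
have mu' n : measurable_fun setT (u n).
  by apply: measurable_fun_ifT => //; apply: measurableT_comp => //; exact: sl_measurable.
have iu n : Int (u n).
  by apply: integrable_real_between (mu' n) (uv n) _ (iv n); exact: integrable_real0.
have shomo r i j : (i <= j)%N -> (conjugate_slope beta r (tau (te i) r) <=
    conjugate_slope beta r (tau (te j) r))%E.
  move=> ij; apply: conjugate_slope_homo => /=.
  by rewrite lerD2r lerD2l lerN2 lef_pV2 ?posrE// ler_nat.
pose f r := if fin r then sl t r else 0%E.
have [||||fi f1] := @monotone_limit_integrable _ _ _ mu u f 1.
- exact: iu.
- move=> r i j ij; rewrite /u; case: ifPn => // fr.
  have [s s0 hs] := conjugate_slope_finP (sfin i r fr).
  have [s' s0' hs'] := conjugate_slope_finP (sfin j r fr).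
  by rewrite -lee_fin -[leLHS]/(fine _)%:E hs hs' /=; have := shomo r i j ij; rewrite hs hs'.
- move=> r; rewrite /f; case: (boolP (fin r)) => fr; last first.
    rewrite [X in ereal_sup X](_ : _ = [set 0%E]) ?ereal_sup1//.
    apply/seteqP; split => [_ [n _ <-]|_ ->]; first by rewrite /u (negbTE fr).
    by exists 0%N => //; rewrite /u (negbTE fr).
  have uE n : (u n r)%:E = conjugate_slope beta r (tau (te n) r).
    by rewrite /u fr; have [s s0 ->] := conjugate_slope_finP (sfin n r fr).
  apply/eqP; rewrite eq_le; apply/andP; split; last first.
    apply: ge_ereal_sup => _ [n _ <-]; rewrite uE; apply: conjugate_slope_homo => /=.
    by rewrite lerD2r gerBl ltW.
  apply: ge_ereal_sup => _ [s /= hs <-].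
  case: hs => [->|[s0 hs]].
    apply: (@le_trans _ _ (u 0%N r)%:E); first by rewrite uE conjugate_slope_ge0.
    by apply: ereal_sup_ubound; exists 0%N.
  have [n hn] : exists n, dbeta beta r s < tau (te n) r.
    have d0 : 0 < tau t r - dbeta beta r s by rewrite subr_gt0.
    have [N _ hN] : \forall n \near \oo, e n < tau t r - dbeta beta r s.
      exact: (cvgr_lt _ (@cvg_harmonic R)).
    exists N; have /= := hN N (leqnn N); lra.
  apply: (@le_trans _ _ (u n r)%:E); first by rewrite uE; exact: conjugate_slope_ge.
  by apply: ereal_sup_ubound; exists n.
- move=> n; apply: le_trans (v1 n); apply: le_Rintegral_setT => // r.
  by have /andP[] := uv n r.
have ae : ae_eq mu setT f (sl t).
  by apply: filterS (cint_fin ct) => r h _; rewrite /f /fin h.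
by have [? ->] := ae_eq_integrable fi (sl_measurable t) ae.
Qed.

Definition segment t u (e : R) : R * R :=
  (t.1 + e * (u.1 - t.1), t.2 + e * (u.2 - t.2)).
Definition direction t u r : R := u.1 - t.1 + (u.2 - t.2) * X r.
(** The density candidate [p_theta] of the parameters [t], see [p_theta_slope]. *)
Definition slope t r : R := fine (conjugate_slope beta r (tau t r)).

Lemma tau_segment t u e r : tau (segment t u e) r = tau t r + e * direction t u r.
Proof. by rewrite /segment /direction/=; ring. Qed.

Lemma slope_ge0 t r : 0 <= slope t r.
Proof. by apply: fine_ge0; exact: conjugate_slope_ge0. Qed.

Lemma slope_measurable t : measurable_fun setT (slope t).
Proof. by apply: measurableT_comp => //; exact: sl_measurable. Qed.

Lemma direction_measurable t u : measurable_fun setT (direction t u).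
Proof. by apply: measurable_funD => //; exact: measurable_funM. Qed.

Definition regular t u r : bool := [&& conjugate beta r (tau t r) \is a fin_num,
  conjugate beta r (tau u r) \is a fin_num & (conjugate_slope beta r (tau t r) < +oo)%E].

Lemma regular_measurable t u : measurable_fun setT (regular t u).
Proof.
apply: measurable_and.
  by apply: (measurable_fun_bool true); apply: emeasurable_fin_num => //; exact: cj_measurable.
apply: measurable_and.
  by apply: (measurable_fun_bool true); apply: emeasurable_fin_num => //; exact: cj_measurable.
by apply: measurable_fun_lte => //; exact: sl_measurable.
Qed.

Lemma regular_ae t u : cint t -> cint u ->
  (\forall r \ae mu, (conjugate_slope beta r (tau t r) < +oo)%E) ->
  \forall r \ae mu, regular t u r.
Proof.
move=> /cint_fin h1 /cint_fin h2 h3.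
by apply: filterS3 h1 h2 h3 => r h1 h2 h3; rewrite /regular h1 h2 h3.
Qed.

Lemma segment_convex_fin t u r (e : R) :
  conjugate beta r (tau t r) \is a fin_num -> conjugate beta r (tau u r) \is a fin_num ->
  0 <= e <= 1 ->
  conjugate beta r (tau (segment t u e) r) \is a fin_num /\
  cr (segment t u e) r <= (1 - e) * cr t r + e * cr u r.
Proof.
move=> ft fu /andP[e0 e1].
have := @conjugate_convex _ _ _ beta hbeta r (tau t r) (tau u r) (cr t r) (cr u r) (1 - e).
rewrite !fineK// => /(_ ltac:(apply/andP; split; lra) (lexx _) (lexx _)).
rewrite (_ : _ + (1 - (1 - e)) * _ = tau (segment t u e) r); last by rewrite /segment/=; ring.
rewrite (_ : 1 - (1 - e) = e); last by ring.
move=> h; have fin : conjugate beta r (tau (segment t u e) r) \is a fin_num.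
  by rewrite fin_numElt conjugate_gtNy// (le_lt_trans h)// ltry.
by split => //; rewrite -lee_fin fineK.
Qed.

Lemma segment_convex t u r (e : R) : regular t u r -> 0 <= e <= 1 ->
  conjugate beta r (tau (segment t u e) r) \is a fin_num /\
  cr (segment t u e) r <= (1 - e) * cr t r + e * cr u r.
Proof. by move=> /and3P[ft fu _]; exact: segment_convex_fin. Qed.

Lemma KR_convex t u (e : R) : cint t -> cint u -> 0 <= e <= 1 ->
  KR (segment t u e) <= (1 - e) * KR t + e * KR u.
Proof.
move=> ct cu e01; have Z := integrable_realZ.
have [it _] := cint_real ct; have [iu _] := cint_real cu.
have [ism _] := cint_real (segment_cint ct cu e01).
rewrite -!RintegralZl// -RintegralD//; try exact: Z.
apply: le_Rintegral_ae => //; first by apply: integrable_realD; exact: Z.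
by apply: filterS2 (cint_fin ct) (cint_fin cu) => r ft fu; have [] := segment_convex_fin ft fu e01.
Qed.

(** Convexity is applied on the shorter segment from [t] to [segment t u e], on which the point for
    [e'] has parameter [e' / e]. *)
Lemma quotient_homo t u r (e e' : R) : regular t u r -> 0 < e' -> e' <= e -> e <= 1 ->
  (cr (segment t u e') r - cr t r) / e' <= (cr (segment t u e) r - cr t r) / e.
Proof.
move=> ru e0' ee e1; have e0 : 0 < e by lra.
have [fin _] := segment_convex ru (ltac:(apply/andP; split; lra) : 0 <= e <= 1).
have /and3P[ft fu St] := ru.
have ru' : regular t (segment t u e) r by rewrite /regular ft fin St.
have l01 : 0 <= e' / e <= 1.
  by apply/andP; split; [rewrite divr_ge0 ?ltW|rewrite ler_pdivrMr// mul1r].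
have [_] := segment_convex ru' l01.
rewrite (_ : tau (segment t (segment t u e) (e' / e)) r = tau (segment t u e') r); last first.
  by rewrite /segment/=; field; rewrite gt_eqF.
move=> h; rewrite ler_pdivrMr//.
rewrite (_ : _ / e * e' = e' / e * (cr (segment t u e) r - cr t r)); last by ring.
lra.
Qed.

Lemma quotient_cvg t u r (e : nat -> R) : regular t u r -> (forall n, 0 < e n) ->
  e n @[n --> \oo] --> 0 ->
  (cr (segment t u (e n)) r - cr t r) / e n @[n --> \oo] --> slope t r * direction t u r.
Proof.
move=> /and3P[ft fu /conjugate_slope_finP[s s0 hs]] e0 ec; rewrite /slope hs/=.
set D := direction t u r.
have [D0|D0] := eqVneq D 0.
  rewrite D0 mulr0; apply: cvg_near_cst; apply: nearW => n.
  by rewrite tau_segment -/D D0 mulr0 addr0 subrr mul0r.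
have hd : e n * D @[n --> \oo] --> (0 : R)^'.
  have : e n * D @[n --> \oo] --> 0.
    by rewrite -(mul0r D); apply: cvgM => //; exact: cvg_cst.
  move=> /cvgrPdist_lt hc A /= [eps /= eps0 hA].
  apply: filterS (hc eps eps0) => n hn; apply: hA => //=.
  by rewrite mulf_neq0// gt_eqF.
have h1 := cvg_comp _ _ hd (conjugate_cvg hbeta hs).
have h2 : ((fun n => (e n * D)^-1 * (fine (conjugate beta r (tau t r + e n * D)) - cr t r)) n * D)
    @[n --> \oo] --> s * D by apply: cvgM; [exact: h1|exact: cvg_cst].
apply: cvg_trans h2; apply: near_eq_cvg; apply: nearW => n /=.
by rewrite tau_segment -/D; field; rewrite D0 gt_eqF.
Qed.

(* The quotients [(K (t + e (u - t)) - K t) / e] decrease with [e], so that monotone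
   convergence applies. *)
Lemma directional_derivative t u (l : R) : cint t -> cint u ->
  (\forall r \ae mu, (conjugate_slope beta r (tau t r) < +oo)%E) ->
  (forall e, 0 < e -> e < 1 -> KR t + e * l <= KR (segment t u e)) ->
  Int (fun r => slope t r * direction t u r) /\
  l <= \int[mu]_r (slope t r * direction t u r).
Proof.
move=> ct cu St hl.
have [it _] := cint_real ct; have [iu _] := cint_real cu.
(* Starting at 1/2 keeps every [e n] strictly below 1, as [hl] requires. *)
pose e n : R := n.+2%:R^-1.
have e0 n : 0 < e n by rewrite invr_gt0.
have e1 n : e n < 1 by rewrite invf_lt1// ltr1n.
have ec : e n @[n --> \oo] --> 0.
  by have := @cvg_harmonic R; rewrite -(cvg_shiftn 1); under eq_fun do rewrite addn1.
have cs n : cint (segment t u (e n)).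
  by apply: segment_cint => //; apply/andP; split; exact: ltW.
have is' n : Int (cr (segment t u (e n))) by have [] := cint_real (cs n).
(* Subtracting the quotients from the one at [e = 1] turns a decreasing sequence into an increasing
   one, with integrals bounded through [l]. *)
pose w n r := if regular t u r then
  (cr u r - cr t r) - (cr (segment t u (e n)) r - cr t r) / e n else 0.
have iq n : Int (fun r => (cr (segment t u (e n)) r - cr t r) / e n).
  rewrite (_ : (fun r => _) = (fun r => (e n)^-1 * (cr (segment t u (e n)) r - cr t r))).
    by apply: integrable_realZ; exact: integrable_realB.
  by apply/funext => r; rewrite mulrC.
have i1 := integrable_realB iu it.
have iw n : Int (w n).
  apply: integrable_real_if; first exact: regular_measurable.
    exact: integrable_realB.
  exact: integrable_real0.
have wE n : \int[mu]_r w n r = (KR u - KR t) - (KR (segment t u (e n)) - KR t) / e n.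
  have -> : \int[mu]_r w n r = \int[mu]_r ((cr u r - cr t r) -
      (cr (segment t u (e n)) r - cr t r) / e n).
    apply: (ae_eq_integrable_real _ _ _).2.
    - exact: integrable_realB.
    - exact: integrable_real_measurable (iw n).
    - by apply: filterS (regular_ae ct cu St) => r h _; rewrite /w h.
  rewrite RintegralB//; last exact: iq.
  rewrite RintegralB//; congr (_ - _).
  rewrite RintegralZr//; last exact: integrable_realB.
  by rewrite RintegralB//; exact: is'.
pose f r := if regular t u r then cr u r - cr t r - slope t r * direction t u r else 0.
have fh r i j : (i <= j)%N -> w i r <= w j r.
  move=> ij; rewrite /w; case: ifPn => // ru; rewrite lerB//.
  apply: quotient_homo => //; last exact: ltW.
  by rewrite lef_pV2 ?posrE// ler_nat !ltnS.
have [||||fi fA] := @monotone_limit_integrable _ _ _ mu w (EFin \o f) (KR u - KR t - l).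
- exact: iw.
- exact: fh.
- move=> r; have h1 : (w n r)%:E @[n --> \oo] --> ereal_sup (range (fun n => (w n r)%:E)).
    by apply: ereal_nondecreasing_cvgn => i j ij; rewrite lee_fin fh.
  rewrite -(cvg_lim _ h1)//; apply/esym/cvg_lim => //; apply: cvg_EFin; first exact: nearW.
  rewrite /w /f/=; case: ifPn => ru; last exact: cvg_cst.
  by apply: cvgB; [exact: cvg_cst|exact: quotient_cvg].
- move=> n; rewrite wE lerD2l lerN2 ler_pdivlMr// mulrC.
  by have := hl (e n) (e0 n) (e1 n); lra.
have mqd : measurable_fun setT (fun r => slope t r * direction t u r).
  by apply: measurable_funM; [exact: slope_measurable|exact: direction_measurable].
have iF := integrable_realB i1 fi.
have [iqd qdE] := ae_eq_integrable_real iF mqd ltac:(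
  by apply: filterS (regular_ae ct cu St) => r h _; rewrite /f h; ring).
split => //; rewrite qdE RintegralB//  RintegralB//.
by move: fA; rewrite integral_real// lee_fin; lra.
Qed.

Lemma support_inequality t u : cint t -> cint u ->
  (\forall r \ae mu, (conjugate_slope beta r (tau t r) < +oo)%E) ->
  Int (fun r => slope t r * direction t u r) ->
  \int[mu]_r (slope t r * direction t u r) <= KR u - KR t.
Proof.
move=> ct cu St iqd.
have [it _] := cint_real ct; have [iu _] := cint_real cu.
have i1 := integrable_realB iu it.
pose f r := if regular t u r then cr u r - cr t r else slope t r * direction t u r.
have ifi : Int f by apply: integrable_real_if => //; exact: regular_measurable.
rewrite -RintegralB//.
have [_ <-] := ae_eq_integrable_real i1 (integrable_real_measurable ifi) ltac:(
  by apply: filterS (regular_ae ct cu St) => r h _; rewrite /f h).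
apply: le_Rintegral_setT => // r; rewrite /f; case: ifPn => // /and3P[ft fu].
move=> /conjugate_slope_finP[s s0 hs].
have := conjugate_subgradient hbeta (tau u r) hs.
rewrite -(fineK ft) -(fineK fu) -EFinD lee_fin /slope hs /direction/=.
rewrite (_ : tau u r - tau t r = u.1 - t.1 + (u.2 - t.2) * X r); last by ring.
lra.
Qed.

Lemma nonneg_ae_eq0 (h : T -> R) : Int h -> (\forall r \ae mu, 0 <= h r) ->
  \int[mu]_r h r <= 0 -> \forall r \ae mu, h r = 0.
Proof.
move=> ih h0 hle.
have mh := integrable_real_measurable ih.
have mEh : measurable_fun setT (EFin \o h) by exact/measurable_EFinP.
have abs0 : (\int[mu]_r `|(EFin \o h) r| = 0)%E.
  apply/eqP; rewrite eq_le; apply/andP; split; last by apply: integral_ge0.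
  rewrite (_ : (\int[mu]_r `|(EFin \o h) r|)%E = (\int[mu]_r (h r)%:E)%E).
    by rewrite integral_real// lee_fin.
  apply: ae_eq_integral => //; first exact: measurableT_comp.
  by apply: filterS h0 => r h0 _ /=; rewrite ger0_norm.
have := (ae_eq_integral_abs mu measurableT mEh).1 abs0.
by apply: filterS => r /(_ I) [].
Qed.

(** If [K] is affine from [t] to [u], the convexity gap at the midpoint vanishes almost everywhere.
    The slope at the midpoint then attains Young's equality at both ends, and
    [conjugate_slope_unique] applies. *)
Lemma slope_unique t u : cint t -> cint u ->
  (\forall r \ae mu, (conjugate_slope beta r (tau t r) < +oo)%E) ->
  (\forall r \ae mu, (conjugate_slope beta r (tau u r) < +oo)%E) ->
  KR t + KR u <= 2 * KR (segment t u 2^-1) ->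
  ae_eq mu setT (slope t) (slope u).
Proof.
move=> ct cu St Su hK.
have [it _] := cint_real ct; have [iu _] := cint_real cu.
have cm : cint (segment t u 2^-1) by apply: segment_cint => //; exact: half_in01.
have [im _] := cint_real cm.
pose h r := 2^-1 * (cr t r + cr u r) - cr (segment t u 2^-1) r.
have ih : Int h.
  by apply: integrable_realB => //; apply: integrable_realZ; exact: integrable_realD.
have h0 : \forall r \ae mu, 0 <= h r.
  apply: filterS (regular_ae ct cu St) => r ru.
  have [_] := segment_convex ru (half_in01 R).
  by rewrite /h; lra.
have hle : \int[mu]_r h r <= 0.
  rewrite RintegralB//; last by apply: integrable_realZ; exact: integrable_realD.
  rewrite RintegralZl//; last exact: integrable_realD.
  by rewrite RintegralD//; lra.
apply: filterS3 (regular_ae ct cu St) Su (nonneg_ae_eq0 ih h0 hle) => r ru Sur hr _.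
have [fm _] := segment_convex ru (half_in01 R).
have /and3P[ft fu Str] := ru.
have Sm : (conjugate_slope beta r (tau (segment t u 2^-1) r) < +oo)%E.
  have [tu|ut] := leP (tau t r) (tau u r).
    apply: le_lt_trans Sur; apply: conjugate_slope_homo; rewrite /segment/=; lra.
  by apply: le_lt_trans Str; apply: conjugate_slope_homo; rewrite /segment/=; lra.
have [s s0 hs] := conjugate_slope_finP Sm.
have [bf cE] := conjugate_slopeE hbeta hs.
have bE : beta r s = (fine (beta r s))%:E by rewrite fineK.
have h1 := fenchel_le beta r (tau t r) s; have h2 := fenchel_le beta r (tau u r) s.
move: h1 h2 cE hr; rewrite /h bE -(fineK ft) -(fineK fu) -(fineK fm) -!EFinB !lee_fin.
rewrite tau_segment (_ : direction t u r = tau u r - tau t r); last by rewrite /direction; ring.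
set bb := fine (beta r s); set a := fine (conjugate beta r (tau t r)).
set c := fine (conjugate beta r (tau u r)).
move=> h1 h2 [cE] /= hr.
have [ea ec] : a <= s * tau t r - bb /\ c <= s * tau u r - bb.
  exact: midpoint_equality cE hr h1 h2.
rewrite /slope (conjugate_slope_unique hbeta s0 bE (tau := tau t r)); last first.
  by rewrite -(fineK ft) lee_fin.
by rewrite (conjugate_slope_unique hbeta s0 bE (tau := tau u r))// -(fineK fu) lee_fin.
Qed.

Lemma young_equality t p : ip p -> cint t ->
  KR t <= t.1 * mass p + t.2 * ex p - en p ->
  \forall r \ae mu, conjugate_slope beta r (tau t r) = (p r)%:E.
Proof.
move=> hp ct hK; have [it _] := cint_real ct.
have ipsi := psi_integrable t.1 t.2 hp.
have ih := integrable_realB it ipsi.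
have hle : \int[mu]_r (cr t r - (tau t r * p r - b p r)) <= 0.
  by rewrite RintegralB// Rintegral_psi//; lra.
have h0 : \forall r \ae mu, 0 <= cr t r - (tau t r * p r - b p r).
  apply: filterS (cint_fin ct) => r fr; rewrite subr_ge0 -lee_fin fineK// mulrC EFinB.
  by rewrite (fineK (profile_fin hp r)); exact: fenchel_le.
apply: filterS2 (cint_fin ct) (nonneg_ae_eq0 ih h0 hle) => r fr hr.
apply: (conjugate_slope_unique hbeta (profile_ge0 hp r) (b := b p r)).
  by rewrite fineK ?(profile_fin hp).
by rewrite -(fineK fr) lee_fin; lra.
Qed.

Lemma slope_energy t : cint t ->
  (\forall r \ae mu, (conjugate_slope beta r (tau t r) < +oo)%E) ->
  Int (slope t) -> Int (fun r => X r * slope t r) ->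
  H mu beta (slope t) = (t.1 * mass (slope t) + t.2 * ex (slope t) - KR t)%:E.
Proof.
move=> ct St iq iXq; have [it _] := cint_real ct.
have Z := integrable_realZ.
have iz : Int (fun r => t.1 * slope t r + t.2 * (X r * slope t r)).
  by apply: integrable_realD; exact: Z.
have ih := integrable_realB iz it.
have mb : measurable_fun setT (fun r => beta r (slope t r)).
  by apply: measurable_beta => //; [exact: slope_measurable|exact: slope_ge0].
have ae : ae_eq mu setT
    (EFin \o (fun r => t.1 * slope t r + t.2 * (X r * slope t r) - cr t r)%R)
    (fun r => beta r (slope t r)).
  apply: filterS2 (cint_fin ct) St => r fr /conjugate_slope_finP[s s0 hs] _.
  have [bf cE] := conjugate_slopeE hbeta hs.
  rewrite /= /slope hs/= cE -(fineK bf) -EFinB /=; congr EFin; ring.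
have [ibq eq] := ae_eq_integrable ih mb ae.
rewrite /H integral_or_pinfty_integrable// eq integral_real//; congr EFin.
by rewrite RintegralB// RintegralD ?RintegralZl//; exact: Z.
Qed.

(** * Dual maximisers *)

Lemma p_theta_slope t : p_theta beta X t.1 t.2 = slope t.
Proof. by apply/funext => r; rewrite /p_theta if_dconjugateE. Qed.

(** At theta2 = 0 the inner dual problem has value at most 0 since energies are nonnegative. The
    point found is the target of the test directions used below. *)
Lemma axis_in_dom : exists x, cint (x, 0 : R).
Proof.
have [|x [cx _]] := @inner_dual_attained 0 0; last by exists x.
move=> p lpp mp; rewrite mul0r add0r oppr_le0 -lee_fin -H_profile; last by case: lpp.
by apply: hH; apply: profile_density => //; case: lpp.
Qed.

Lemma KR_ge t : cint t -> t.1 + t.2 * ex p0 <= KR t.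
Proof.
move=> ct; have := young_integral hp0 ct.
by have [_ ->] := cint_real ct; rewrite lee_fin hmass hen mulr1 subr0.
Qed.

(** Maximality of the dual value, cleared of the division by the negative [t.2]: [v] is the maximum,
    and an affine function of slope [(1, v)] lies below [K] on the half-plane and touches it at
    [t]. *)
Record is_max (k v : R) t : Prop := IsMax {
  max_lt0 : t.2 < 0 ;
  max_cint : cint t ;
  max_eq : KR t = t.1 + t.2 * v - k ;
  max_le : forall u, cint u -> u.2 < 0 -> u.1 + u.2 * v - k <= KR u }.

Lemma dual_valueE k t : cint t -> dual_value mu beta X k t = ((k + KR t - t.1) / t.2)%:E.
Proof.
by move=> ct; rewrite /dual_value; have [_ ->] := cint_real ct.
Qed.

Lemma dual_value_pinfty k t : t.2 < 0 -> ~ cint t -> dual_value mu beta X k t = -oo%E.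
Proof.
move=> t0 nct; rewrite /dual_value.
have -> : K mu beta X t.1 t.2 = +oo%E.
  apply/eqP; rewrite -leye_eq leNgt; apply/negP => h; apply: nct.
  exact/dom_K_integrable.
by rewrite addey// addye// lt0_mulye// lte_fin invr_lt0.
Qed.

Lemma is_max_maximiser k v t : is_max k v t -> dual_maximisers mu beta X k t.
Proof.
move=> [t0 ct eq le]; split => // u u0.
have [cu|ncu] := pselect (cint u); last by rewrite dual_value_pinfty// leNye.
rewrite !dual_valueE// lee_fin eq.
have -> : (k + (t.1 + t.2 * v - k) - t.1) / t.2 = v by field; rewrite lt_eqF.
by rewrite ler_ndivrMr//; have := le u cu u0; lra.
Qed.

Lemma maximiser_is_max k t : (exists2 u, cint u & u.2 < 0) ->
  dual_maximisers mu beta X k t -> exists v, is_max k v t.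
Proof.
move=> [u0 cu0 u00] [t0 tmax].
have ct : cint t.
  apply: contrapT => nct; have := tmax u0 u00.
  by rewrite (dual_value_pinfty _ t0 nct) (dual_valueE _ cu0) leeNy_eq.
exists ((k + KR t - t.1) / t.2); split => //.
  by field; rewrite lt_eqF.
move=> u cu uneg; have := tmax u uneg; rewrite !dual_valueE// lee_fin.
rewrite ler_ndivrMr// => h; lra.
Qed.

Lemma is_max_value k v v' t t' : is_max k v t -> is_max k v' t' -> v = v'.
Proof.
move=> [t0 ct teq tle] [t0' ct' teq' tle'].
have h1 := tle t' ct' t0'; have h2 := tle' t ct t0.
have h3 : t'.2 * v <= t'.2 * v' by lra.
have h4 : t.2 * v' <= t.2 * v by lra.
by apply/eqP; rewrite eq_le -(ler_nM2l t0) h4 -(ler_nM2l t0') h3.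
Qed.

Lemma is_max_slope k v t : is_max k v t ->
  [/\ \forall r \ae mu, (conjugate_slope beta r (tau t r) < +oo)%E,
    Int (slope t) & mass (slope t) <= 1].
Proof.
move=> [t0 ct teq tle].
have [|si s1] := slope_mass_le1 ct.
  by move=> x cx; have /= := tle (x, t.2) cx t0; lra.
have St : \forall r \ae mu, (conjugate_slope beta r (tau t r) < +oo)%E.
  have := integrable_ae measurableT si.
  by apply: filterS => r /(_ I); rewrite fin_numElt => /andP[].
have mE : measurable_fun setT (EFin \o slope t).
  by apply/measurable_EFinP; exact: slope_measurable.
have ae : ae_eq mu setT (sl t) (EFin \o slope t).
  apply: filterS St => r /conjugate_slope_finP[s _ hs] _.
  by rewrite /slope/= hs.
have [i1 e1] := ae_eq_integrable si mE ae; split => //.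
by rewrite -lee_fin -integral_real// e1.
Qed.

Lemma is_max_unique k v t u : is_max k v t -> is_max k v u ->
  ae_eq mu setT (slope t) (slope u).
Proof.
move=> ht hu; have [St _ _] := is_max_slope ht; have [Su _ _] := is_max_slope hu.
have [t0 ct teq tle] := ht; have [u0 cu ueq ule] := hu.
apply: slope_unique => //.
have cm : cint (segment t u 2^-1) by apply: segment_cint => //; exact: half_in01.
have m0 : (segment t u 2^-1).2 < 0 by rewrite /segment/=; lra.
by have := tle _ cm m0; rewrite teq ueq /segment/=; lra.
Qed.

(** The bound [u.2 <= 0] keeps the segment from [t], short of [u], in the open half-plane covered by
    maximality, while [u] itself may lie on the axis. *)
Lemma is_max_direction k v t u : is_max k v t -> cint u -> u.2 <= 0 ->
  Int (fun r => slope t r * direction t u r) /\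
  u.1 - t.1 + (u.2 - t.2) * v <= \int[mu]_r (slope t r * direction t u r).
Proof.
move=> ht cu u0; have [St _ _] := is_max_slope ht; have [t0 ct teq tle] := ht.
apply: directional_derivative => // e e0 e1.
have e01 : 0 <= e <= 1 by rewrite !ltW.
have s0 : (segment t u e).2 < 0.
  rewrite /segment/= (_ : _ + _ = (1 - e) * t.2 + e * u.2); last by ring.
  have : (1 - e) * t.2 < 0 by rewrite pmulr_rlt0// subr_gt0.
  have : e * u.2 <= 0 by rewrite pmulr_rle0.
  lra.
by have := tle _ (segment_cint ct cu e01) s0; rewrite teq /segment/=; lra.
Qed.

Lemma direction_integral t u : Int (slope t) -> Int (fun r => X r * slope t r) ->
  Int (fun r => slope t r * direction t u r) /\
  \int[mu]_r (slope t r * direction t u r) =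
    (u.1 - t.1) * mass (slope t) + (u.2 - t.2) * ex (slope t).
Proof.
move=> iq iX; have Z := integrable_realZ.
have -> : (fun r => slope t r * direction t u r) =
    (fun r => (u.1 - t.1) * slope t r + (u.2 - t.2) * (X r * slope t r)).
  by apply/funext => r; rewrite /direction; ring.
split; first by apply: integrable_realD; exact: Z.
by rewrite RintegralD ?RintegralZl//; exact: Z.
Qed.

(** Towards a point of the axis, the coefficient of [X] in the direction is [- t.2], which is
    nonzero, so [X] can be solved for. *)
Lemma is_max_intX k v t : is_max k v t -> Int (fun r => X r * slope t r).
Proof.
move=> ht; have [x cx] := axis_in_dom; have [_ iq _] := is_max_slope ht.
have [id _] := is_max_direction ht cx (lexx _).
have t0 := max_lt0 ht; have tn : - t.2 != 0 by rewrite oppr_eq0 lt_eqF.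
have := integrable_realZ (- t.2)^-1 (integrable_realB id (integrable_realZ (x - t.1) iq)).
congr (Int _); apply/funext => r; rewrite /direction/=; field.
by rewrite lt_eqF.
Qed.

Lemma is_max_first_order k v t u : is_max k v t -> cint u -> u.2 <= 0 ->
  u.1 - t.1 + (u.2 - t.2) * v <=
    (u.1 - t.1) * mass (slope t) + (u.2 - t.2) * ex (slope t).
Proof.
move=> ht cu u0; have [_ iq _] := is_max_slope ht; have iX := is_max_intX ht.
by have [_] := is_max_direction ht cu u0; rewrite (direction_integral u iq iX).2.
Qed.

Lemma is_max_mass1 k v t : (forall x, cint (x, 0 : R)) -> is_max k v t -> mass (slope t) = 1.
Proof.
move=> haxis ht; have [_ _ q1] := is_max_slope ht.
apply/eqP; rewrite eq_le q1/= leNgt; apply/negP => qlt.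
have d0 : 0 < 1 - mass (slope t) by rewrite subr_gt0.
(* The move to [(t.1 + y, 0)] has [y * (1 - mass (slope t)) = c], one more than the other terms of
   the first-order inequality can compensate. *)
pose c : R := `|t.2 * (v - ex (slope t))| + 1.
pose y : R := c / (1 - mass (slope t)).
have yE : y * mass (slope t) = y - c by rewrite /y; field; rewrite gt_eqF.
have := is_max_first_order ht (haxis (t.1 + y)) (lexx _).
have := ler_norm (t.2 * (v - ex (slope t))).
rewrite /= -[`|_|](addrK 1) -/c; lra.
Qed.

(** All admissible densities compete in [V], including those of infinite expectation; the value
    [-oo] has to be excluded separately. *)
Lemma weak_duality k v t p w : is_max k v t -> is_density mu p -> (H mu beta p <= k%:E)%E ->
  has_integral mu (fun r => (X r * p r)%:E) w -> (v%:E <= w)%E.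
Proof.
move=> [t0 ct teq _] dp Hk hw; have Hfin : (H mu beta p < +oo)%E := le_lt_trans Hk (ltry _).
have [mp pp0 pm] := dp; case: w hw => [w| |] hw; last 2 first.
- by rewrite leey.
- exfalso; have [_ intE] := hw; have mXp := measurable_funM hX mp.
  have mb : measurable_fun setT (fun r => beta r (p r)) by exact: measurable_beta.
  have ib : mu.-integrable setT (fun r => beta r (p r)).
    by apply: integral_or_pinfty_lty => //; exact: lt_le_trans (hH dp).
  have ipr : mu.-integrable setT (EFin \o p).
    apply/integrableP; split; first exact/measurable_EFinP.
    under eq_integral do rewrite gee0_abs ?lee_fin//.
    by rewrite pm ltry.
  (* Young's inequality divided by [- t.2] bounds the negative part of [X * p] by this integrable
     function. *)
  pose g r := ((- t.2)^-1%:E * (`|cj t r| + `|beta r (p r)| + `|t.1%:E * (p r)%:E|))%E.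
  have ig : mu.-integrable setT g.
    apply: integrableZl => //; apply: integrableD => //.
      by apply: integrableD => //; exact: integrable_abse.
    by apply: (integrable_abse (f := fun r => t.1%:E * (p r)%:E)%E); exact: integrableZl.
  have n0 : 0 < - t.2 by rewrite oppr_gt0.
  have neg : (\int[mu]_r ((EFin \o (fun r => X r * p r)%R)^\- r) < +oo)%E.
    apply: (@le_lt_trans _ _ (\int[mu]_r g r)%E); last first.
      by have := integrable_fin_num measurableT ig; rewrite fin_numElt => /andP[].
    apply: ge0_le_integral => //.
    - by apply: measurable_funeneg; apply/measurable_EFinP.
    - exact: measurable_int ig.
    move=> r _; rewrite funenegE ge_max; apply/andP; split; last first.
      by rewrite /g mule_ge0// ?lee_fin ?invr_ge0 ?(ltW n0)// !adde_ge0.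
    have := fenchel_le beta r (tau t r) (p r).
    rewrite /g; have := conjugate_gtNy hbeta r (tau t r).
    have := integrand_gtNy hbeta r (p r).
    case: (beta r (p r)) => [b0| |]//; case: (conjugate _ _ _) => [c0| |]// _ _;
      rewrite ?gt0_muley ?lte_fin ?invr_gt0//= ?leey//.
    rewrite -!EFinD -EFinM !lee_fin => h.
    rewrite ler_pdivlMl//.
    have := ler_norm c0; have := ler_norm b0; have := ler_norm (- (t.1 * p r)).
    rewrite normrN; lra.
  have p0' : (0 <= \int[mu]_r (EFin \o (fun r => X r * p r)%R)^\+ r)%E.
    exact: integral_ge0.
  have n0' : (0 <= \int[mu]_r (EFin \o (fun r => X r * p r)%R)^\- r)%E.
    exact: integral_ge0.
  move: intE; rewrite integralE; move: neg p0' n0'.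
  by case: (\int[mu]_r (EFin \o (fun r => (X r * p r)%R))^\+ r)%E => [x| |];
    case: (\int[mu]_r (EFin \o (fun r => (X r * p r)%R))^\- r)%E => [y| |].
have [iX eX] := has_integral_fin (measurable_funM hX mp) hw.
have [p' [hp' _ m' e' HE]] := density_profile dp Hfin iX.
move: Hk; rewrite HE lee_fin => Hk.
have := young_integral hp' ct; have [_ ->] := cint_real ct.
rewrite lee_fin m' e' eX teq mulr1 => h.
by rewrite lee_fin -(ler_nM2l t0); lra.
Qed.

Lemma exists_max (k : R) : 0 < k -> (k%:E < k_max mu beta X)%E ->
  exists v t, is_max k v t /\ V mu beta X k = v%:E.
Proof.
move=> k0 kk; have [v [t1 [t2 [t0 vb ci cK hp]]]] := dual_attained k0 kk.
pose t := (t1, t2).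
have lb u : cint u -> u.2 < 0 -> u.1 + u.2 * v - k <= KR u.
  move=> cu u0; rewrite -lee_fin; apply/lee_addgt0Pr => e e0.
  (* Multiplication by [u.2] turns this tolerance into exactly [e]. *)
  have n0 : 0 < e / - u.2 by rewrite divr_gt0// oppr_gt0.
  have [p [[ipp _] mp pk pe]] := hp _ n0.
  have := young_integral ipp cu; have [_ ->] := cint_real cu.
  rewrite -EFinD !lee_fin mp => h.
  have : u.2 * (v + e / - u.2) <= u.2 * ex p by rewrite ler_nM2l// ltW.
  have -> : u.2 * (v + e / - u.2) = u.2 * v - e by field; rewrite lt_eqF.
  lra.
have hmax : is_max k v t.
  split => //; apply/eqP; rewrite eq_le lb// andbT.
  by have [_ KE] := cint_real (t := t) ci; rewrite -lee_fin -KE.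
exists v, t; split => //; apply/eqP; rewrite eq_le; apply/andP; split.
  apply/lee_addgt0Pr => e e0; have [p [[ipp _] mp pk pe]] := hp _ e0.
  apply: (@le_trans _ _ (ex p)%:E); last by rewrite -EFinD lee_fin ltW.
  apply: ereal_inf_lbound; exists p; split.
  - exact: profile_density.
  - by rewrite H_profile// lee_fin.
  - exact: has_integral_real (profile_intX ipp).
by apply: le_ereal_inf_tmp => w [p [dp Hk hw]]; exact: weak_duality hmax dp Hk hw.
Qed.

(** * The partial infimum [G] and its right derivative *)

Local Notation Gx := (G mu beta X).

Lemma G_le u x : cint u -> u.2 = x -> (Gx x <= (KR u - u.1)%:E)%E.
Proof.
move=> cu <-; apply: ereal_inf_lbound; exists u.1 => //.
by have [_ ->] := cint_real cu.
Qed.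

Lemma G_ge x A : (forall u, cint u -> u.2 = x -> A <= KR u - u.1) -> (A%:E <= Gx x)%E.
Proof.
move=> hA; apply: le_ereal_inf_tmp => _ [t1 _ <-].
have [cu|ncu] := pselect (cint ((t1, x) : R * R)).
  by have [_ /= ->] := cint_real cu; rewrite lee_fin; exact: hA cu erefl.
have -> : K mu beta X t1 x = +oo%E; last by rewrite leey.
apply/eqP; rewrite -leye_eq leNgt; apply/negP => h; apply: ncu.
exact/dom_K_integrable.
Qed.

Lemma G_gtNy x : (-oo < Gx x)%E.
Proof.
apply: lt_le_trans (ltNyr (x * ex p0)) _; apply: G_ge => u cu <-.
by have := KR_ge cu; lra.
Qed.

Lemma G_lt x a : (Gx x < a%:E)%E -> exists u, [/\ cint u, u.2 = x & KR u - u.1 < a].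
Proof.
move=> ha; apply: contrapT => hno; move: ha; rewrite ltNge => /negP; apply.
apply: G_ge => u cu ux; rewrite leNgt; apply/negP => h; apply: hno.
by exists u.
Qed.

Lemma G_segment x a B (h h' : R) : Gx x = a%:E -> 0 < h -> h <= h' ->
  (Gx (x + h') <= B%:E)%E -> (Gx (x + h) <= (a + h / h' * (B - a))%:E)%E.
Proof.
move=> ga h0 hh gB; apply/lee_addgt0Pr => e e0.
have h'0 : 0 < h' by lra.
have [t [ct tx tlt]] : exists u, [/\ cint u, u.2 = x & KR u - u.1 < a + e].
  by apply: G_lt; rewrite ga lte_fin ltrDl.
have [u [cu ux ult]] : exists u, [/\ cint u, u.2 = x + h' & KR u - u.1 < B + e].
  by apply: G_lt; apply: le_lt_trans gB _; rewrite lte_fin ltrDl.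
have l01 : 0 <= h / h' <= 1.
  by apply/andP; split; [rewrite divr_ge0 ?ltW|rewrite ler_pdivrMr// mul1r].
have cs := segment_cint ct cu l01.
have sx : (t.1 + h / h' * (u.1 - t.1), t.2 + h / h' * (u.2 - t.2)).2 = x + h.
  by rewrite /= tx ux; field; rewrite gt_eqF.
apply: le_trans (G_le cs sx) _; rewrite -EFinD lee_fin.
exact: convex_combination_le l01 (KR_convex ct cu l01) tlt ult.
Qed.

Let quot x h := ((Gx (x + h) - Gx x) * (h^-1)%:E)%E.

(** Convexity of [G] in extended form, with [+oo] allowed outside the domain; it makes the right
    derivative an infimum of quotients. *)
Lemma quot_homo x a : Gx x = a%:E ->
  {in `]0, +oo[ &, {homo quot x : h h' / h <= h' >-> (h <= h')%E}}.
Proof.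
move=> ga h h'; rewrite !in_itv/= !andbT => h0 h'0 hh; rewrite /quot ga.
case E : (Gx (x + h')) => [B| |].
- have := G_segment ga h0 hh (_ : (Gx (x + h') <= B%:E)%E); rewrite E => /(_ (lexx _)).
  case: (Gx (x + h)) (G_gtNy (x + h)) => [A| |]// _.
  rewrite -!EFinB -!EFinM !lee_fin => hA.
  rewrite ler_pdivrMr// (_ : (B - a) / h' * h = h / h' * (B - a)); last by ring.
  by rewrite lerBlDl.
- by rewrite addye// gt0_mulye ?leey// lte_fin invr_gt0.
- by have := G_gtNy (x + h'); rewrite E.
Qed.

Lemma right_derivativeE x a : Gx x = a%:E ->
  right_derivative Gx x = ereal_inf [set quot x h | h in [set` `]0, +oo[]].
Proof.
move=> ga; apply: cvg_lim => //.
apply: (@nondecreasing_at_right_cvge _ (quot x) 0 +oo%O) => //.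
exact: quot_homo ga.
Qed.

Lemma right_derivative_ge x a E : Gx x = a%:E ->
  (forall u, cint u -> x < u.2 -> a + (u.2 - x) * E <= KR u - u.1) ->
  (E%:E <= right_derivative Gx x)%E.
Proof.
move=> ga hE; rewrite (right_derivativeE ga).
apply: le_ereal_inf_tmp => _ [h /= + <-]; rewrite in_itv/= andbT => h0.
rewrite /quot ga -lee_pdivrMr ?invr_gt0// invrK.
rewrite leeBrDr// -EFinM -EFinD; apply: G_ge => u cu ux.
by have := hE u cu; rewrite ux ltrDl => /(_ h0); lra.
Qed.

Lemma right_derivative_le x a u g : Gx x = a%:E -> cint u -> x < u.2 ->
  (g%:E <= right_derivative Gx x)%E -> a + (u.2 - x) * g <= KR u - u.1.
Proof.
move=> ga cu xu; rewrite (right_derivativeE ga) => hg.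
have h0 : 0 < u.2 - x by rewrite subr_gt0.
have : (g%:E <= quot x (u.2 - x))%E.
  by apply: le_trans hg _; apply: ereal_inf_lbound; exists (u.2 - x) => //=; rewrite in_itv/= h0.
rewrite /quot ga -lee_pdivrMr ?invr_gt0// invrK leeBrDr// -EFinM -EFinD.
move=> /le_trans h; have := h _ (G_le cu (_ : u.2 = x + (u.2 - x))).
by rewrite lee_fin => /(_ ltac:(ring)); lra.
Qed.

Lemma right_derivative_lty x a u : Gx x = a%:E -> cint u -> x < u.2 ->
  (right_derivative Gx x < +oo)%E.
Proof.
move=> ga cu xu; rewrite ltNge leye_eq; apply/negP => /eqP gE.
have h0 : 0 < u.2 - x by rewrite subr_gt0.
(* A slope just too steep: its line passes one unit above [KR u - u.1] at [u]. *)
have := right_derivative_le (g := (KR u - u.1 - a + 1) / (u.2 - x)) ga cu xu.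
rewrite gE leey => /(_ isT); rewrite mulrC mulfVK ?gt_eqF//; lra.
Qed.

(** * From dual maximisers to worst case densities *)

Lemma slope_densityP t : Int (slope t) ->
  is_density mu (slope t) <-> mass (slope t) = 1.
Proof.
move=> iq; split=> [[_ _]|m1]; first by rewrite integral_real// => -[].
split; [exact: slope_measurable|exact: slope_ge0|].
by rewrite integral_real// m1.
Qed.

Lemma theta_min_le u : cint u -> (theta_min mu beta X <= u.2%:E)%E.
Proof.
move=> cu; apply: ereal_inf_lbound; exists u.2 => //; exists u => //.
exact/dom_K_integrable.
Qed.

Lemma localiser_max k : 0 < k -> (k%:E < k_max mu beta X)%E ->
  exists v t, [/\ is_max k v t, V mu beta X k = v%:E & localiser mu beta X k = slope t].
Proof.
move=> k0 kk; have [v [t0 [ht0 VE]]] := exists_max k0 kk.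
have hm0 := is_max_maximiser ht0.
exists v, (xget ((0, 0) : R * R) (dual_maximisers mu beta X k)).
have hx : dual_maximisers mu beta X k (xget ((0, 0) : R * R) (dual_maximisers mu beta X k)).
  exact: xgetPex (ex_intro _ _ hm0).
have [|v' hv'] := maximiser_is_max _ hx.
  by exists t0; [exact: max_cint ht0|exact: max_lt0 ht0].
split => //; first by rewrite (is_max_value ht0 hv').
by rewrite /localiser p_theta_slope.
Qed.

(** Once the mass is 1, the theta1 terms cancel from the first-order inequality towards the axis. *)
Lemma dual_le_expectation k v t : is_max k v t -> mass (slope t) = 1 -> v <= ex (slope t).
Proof.
move=> ht m1; have [x cx] := axis_in_dom.
have := is_max_first_order ht cx (lexx _).
rewrite m1 mulr1 lerD2l /= sub0r ler_pM2l// oppr_gt0; exact: max_lt0 ht.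
Qed.

Lemma max_at_theta_min k v t : is_max k v t -> mass (slope t) = 1 ->
  (forall u, cint u -> t.2 <= u.2) ->
  [/\ theta_min mu beta X = t.2%:E, Theta2 mu beta X t.2,
    Gx t.2 = (t.2 * v - k)%:E & ((ex (slope t))%:E <= right_derivative Gx t.2)%E].
Proof.
move=> ht m1 tmin; have [St iq _] := is_max_slope ht; have iX := is_max_intX ht.
have [t0 ct teq tle] := ht.
have dt : Theta2 mu beta X t.2 by exists t => //; exact/dom_K_integrable.
have GE : Gx t.2 = (t.2 * v - k)%:E.
  apply/eqP; rewrite eq_le; apply/andP; split.
    by apply: le_trans (G_le ct erefl) _; rewrite lee_fin; lra.
  by apply: G_ge => u cu ux; have := tle u cu; rewrite ux => /(_ t0); lra.
split => //.
  apply/eqP; rewrite eq_le theta_min_le//=.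
  apply: le_ereal_inf_tmp => _ [_ [u /dom_K_integrable cu <-] <-].
  by rewrite lee_fin tmin.
apply: right_derivative_ge GE _ => u cu xu.
have [id dE] := direction_integral u iq iX.
by have := support_inequality ct cu St id; rewrite dE m1; lra.
Qed.

(** The reverse of [dual_le_expectation] follows by moving left in theta2 when the domain allows it;
    otherwise the maximiser sits at theta_min and the failure of (C) replaces that move. *)
Lemma max_worst_case k v t : is_max k v t -> V mu beta X k = v%:E ->
  mass (slope t) = 1 -> ~ (condition_D mu beta X /\ condition_C mu beta X k) ->
  worst_case_density mu beta X k (slope t).
Proof.
move=> ht VE m1 nDC; have [St iq _] := is_max_slope ht; have iX := is_max_intX ht.
have [t0 ct teq tle] := ht.
have exE : ex (slope t) = v.
  apply/eqP; rewrite eq_le (dual_le_expectation ht m1) andbT.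
  have [[u cu ut]|hno] := pselect (exists2 u, cint u & u.2 < t.2).
    have := is_max_first_order ht cu (ltW (lt_trans ut t0)).
    by rewrite m1 mulr1 lerD2l ler_nM2l// subr_lt0.
  have tmin u : cint u -> t.2 <= u.2.
    by move=> cu; rewrite leNgt; apply/negP => h; apply: hno; exists u.
  have [thE T2 GE rd] := max_at_theta_min ht m1 tmin.
  have [x cx] := axis_in_dom.
  have rdy := right_derivative_lty GE cx (_ : t.2 < (x, 0 : R).2).
  have hD : condition_D mu beta X.
    by rewrite /condition_D thE; split => //; apply: lt_le_trans rd; rewrite ltNyr.
  have nC : ~ condition_C mu beta X k by move=> hC; apply: nDC.
  move: nC rd (rdy t0); rewrite /condition_C /k_cr thE /= GE.
  case: (right_derivative _ _) => [g| |]// nC.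
  rewrite lee_fin => Eg _.
  (* As [G t.2 = t.2 * v - k] and [t.2 < 0], the inequality [k <= k_cr] says [g <= v], while
     [ex (slope t) <= g]. *)
  have : (k%:E <= - (t.2 * v - k)%:E + t.2%:E * g%:E)%E by rewrite leNgt; apply/negP.
  rewrite -EFinM -EFinN -EFinD lee_fin => kle.
  have : t.2 * g <= t.2 * ex (slope t) by rewrite ler_nM2l.
  by move=> gE; rewrite -(ler_nM2l t0); lra.
split.
- exact/slope_densityP.
- by rewrite slope_energy// lee_fin m1 exE teq; lra.
- by rewrite VE -exE; exact: has_integral_real.
Qed.

(* [x] is [theta_min], [a] is [G x] and [g] the right derivative of [G] at [x]. *)
Lemma condition_D_data t0 : cint t0 -> t0.2 < 0 -> condition_D mu beta X ->
  exists x a g, [/\ theta_min mu beta X = x%:E, x < 0, Gx x = a%:E,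
    k_cr mu beta X = (x * g - a)%:E &
    forall u, cint u -> x <= u.2 /\ a + (u.2 - x) * g <= KR u - u.1].
Proof.
move=> ct0 t00 [thfin [u0 /dom_K_integrable cu0 u0E] rdNy].
have thE : theta_min mu beta X = (fine (theta_min mu beta X))%:E by rewrite fineK.
move: thE u0E rdNy; rewrite /k_cr; set x := fine _ => thE u0E rdNy.
have xle u : cint u -> x <= u.2 by move=> cu; rewrite -lee_fin -thE theta_min_le.
have x0 : x < 0 by apply: le_lt_trans (xle _ ct0) t00.
have [a ga] : exists a, Gx x = a%:E.
  have := G_gtNy x; have := G_le cu0 u0E.
  by case: (Gx x) => [a| |]//; exists a.
have [x1 cx1] := axis_in_dom.
have rdy := right_derivative_lty ga cx1 (_ : x < (x1, 0 : R).2).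
have [g gE] : exists g, right_derivative Gx x = g%:E.
  have := rdy x0; move: rdNy.
  by case: (right_derivative _ _) => [g| |]//; exists g.
exists x, a, g; split => //.
  by rewrite thE gE ga -EFinM -EFinN -EFinD; congr EFin; ring.
move=> u cu; split; first exact: xle.
have := xle u cu; rewrite le_eqVlt => /predU1P[xu|xu]; last first.
  by apply: (right_derivative_le ga cu xu); rewrite gE.
have ux0 : u.2 - x = 0 by rewrite xu subrr.
have hG := G_le cu (esym xu); move: hG; rewrite ga lee_fin ux0 mul0r addr0; exact.
Qed.

(** Level [k] and level [k_cr] have the maximiser [t] in common, with dual values [v] and [g > v].
    Uniqueness at level [k_cr] identifies the three functions. *)
Lemma critical_case k : 0 < k -> (k%:E < k_max mu beta X)%E ->
  condition_D mu beta X -> condition_C mu beta X k ->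
  [/\ ae_eq mu setT (localiser mu beta X k) (localiser mu beta X (fine (k_cr mu beta X))),
      ae_eq mu setT (localiser mu beta X (fine (k_cr mu beta X)))
        (q_theta mu beta X (fine (theta_min mu beta X))) &
      ~ exists p, worst_case_density mu beta X k p].
Proof.
move=> k0 kk hD hC.
have [v [t [ht VE locE]]] := localiser_max k0 kk.
have [t0 ct teq tle] := ht.
have [x [a [g [thE x0 ga kE lb]]]] := condition_D_data ct t0 hD.
move: hC; rewrite /condition_C kE lte_fin thE locE /= => hC.
have aE : x * v - k <= a.
  rewrite -lee_fin -ga; apply: G_ge => u cu ux.
  by have := tle u cu; rewrite ux => /(_ x0); lra.
have [xt] := lb t ct; rewrite teq => lbt.
have vg : v < g.
  have : 0 < t.2 * (v - g) by lra.
  by rewrite nmulr_rgt0// subr_lt0.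
(* The line of slope [g] through [(x, a)] lies below [K] at [t], and [a] is at least [x * v - k]; as
   [v < g], a maximiser to the right of [x] would contradict the two. *)
have tx : t.2 = x.
  apply/eqP; rewrite eq_le xt andbT.
  have : (x - t.2) * (v - g) <= 0 by lra.
  by rewrite nmulr_lle0 ?subr_lt0// subr_ge0.
have aE' : a = x * v - k.
  by apply/eqP; rewrite eq_le aE andbT; move: lbt; rewrite tx; lra.
pose c := x * g - a.
(* At theta_min every minimiser of [K - theta1] touches the line of slope [g], hence is a maximiser
   for the level [c], which is [k_cr]. *)
have crit u : cint u -> u.2 = x -> KR u - u.1 = a -> is_max c g u.
  move=> cu ux ua; split => //; first by rewrite ux.
    by have : u.2 * g = x * g by [rewrite ux]; rewrite /c; lra.
  by move=> w cw w0; have [_] := lb w cw; rewrite /c; lra.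
have htc : is_max c g t by apply: crit => //; rewrite teq tx aE'; lra.
have hxc : dual_maximisers mu beta X c (xget ((0, 0) : R * R) (dual_maximisers mu beta X c)).
  exact: xgetPex (ex_intro _ _ (is_max_maximiser htc)).
have locc : exists2 w, is_max c g w & localiser mu beta X c = slope w.
  have [|g' hg'] := maximiser_is_max _ hxc; first by exists t.
  exists (xget ((0, 0) : R * R) (dual_maximisers mu beta X c)).
    by rewrite (is_max_value htc hg').
  by rewrite /localiser p_theta_slope.
have [w hw ->] := locc.
have qE : exists2 s, is_max c g s & q_theta mu beta X x = slope s.
  rewrite /q_theta; set s1 := xget _ _.
  have hs1 : (K mu beta X s1 x - s1%:E = Gx x)%E.
    apply: (@xgetPex _ 0 [set t1 | K mu beta X t1 x - t1%:E = Gx x]%E).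
    exists t.1; rewrite /= -tx; have [_ ->] := cint_real ct.
    by rewrite teq tx ga aE' -EFinB; congr EFin; ring.
  have cs : cint ((s1, x) : R * R).
    apply/dom_K_integrable; rewrite /dom_K/= ltNge leye_eq; apply/negP => /eqP Ky.
    by move: hs1; rewrite Ky ga.
  exists (s1, x); last by rewrite -p_theta_slope.
  apply: crit => //; have [_ KE] := cint_real cs.
  by move: hs1; rewrite -[x]/((s1, x).2) -[s1]/((s1, x).1) KE ga => -[].
have [s hs ->] := qE.
split; [exact: is_max_unique htc hw|exact: is_max_unique hw hs|].
move=> [p [dp Hp]]; rewrite VE => hp.
have [mp _ _] := dp.
have Hfin : (H mu beta p < +oo)%E := le_lt_trans Hp (ltry _).
have [iX eX] := has_integral_fin (measurable_funM hX mp) hp.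
have [p' [hp' _ m' e' HE]] := density_profile dp Hfin iX.
move: Hp; rewrite HE lee_fin => Hp.
have eqp : \forall r \ae mu, conjugate_slope beta r (tau t r) = (p' r)%:E.
  by apply: young_equality => //; rewrite teq m' e' eX; lra.
have ae : ae_eq mu setT p' (slope t).
  by apply: filterS eqp => r h _; rewrite /slope h.
have [iq mq] := ae_eq_integrable_real (profile_int hp') (slope_measurable t) ae.
have aeX : ae_eq mu setT (fun r => X r * p' r) (fun r => X r * slope t r).
  by apply: filterS ae => r h rT; rewrite h.
have [iXq eq] := ae_eq_integrable_real (profile_intX hp')
  (measurable_funM hX (slope_measurable t)) aeX.
have [x1 cx1] := axis_in_dom.
(* The first-order inequality is taken at level [c]: its value [g] would have to be at most
   [ex (slope t)], which equals [v] if a worst case density exists. *)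
have := is_max_first_order htc cx1 (lexx _).
rewrite mq m' eq e' eX mulr1 lerD2l /= sub0r ler_pM2l ?oppr_gt0//.
by rewrite leNgt vg.
Qed.

Lemma localiser_theorem :
  (forall k : R, 0 < k -> (k%:E < k_max mu beta X)%E ->
     (is_density mu (localiser mu beta X k) ->
      ~ (condition_D mu beta X /\ condition_C mu beta X k) ->
      worst_case_density mu beta X k (localiser mu beta X k))
     /\
     (condition_D mu beta X -> condition_C mu beta X k ->
      [/\ localiser mu beta X k
            = localiser mu beta X (fine (k_cr mu beta X)) %[ae mu],
          localiser mu beta X (fine (k_cr mu beta X))
            = q_theta mu beta X (fine (theta_min mu beta X)) %[ae mu] &
          ~ exists p : T -> R, worst_case_density mu beta X k p]))
  /\
  ((forall t1 : R, dom_K mu beta X (t1, 0)) ->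
   forall k : R, 0 < k -> (k%:E < k_max mu beta X)%E ->
     is_density mu (localiser mu beta X k) /\
     (~ (condition_D mu beta X /\ condition_C mu beta X k) ->
      worst_case_density mu beta X k (localiser mu beta X k))).
Proof.
split=> [k k0 kk|haxis k k0 kk].
  split; last exact: critical_case.
  have [v [t [ht VE ->]]] := localiser_max k0 kk; have [_ iq _] := is_max_slope ht.
  by move=> /slope_densityP -/(_ iq); exact: max_worst_case ht VE.
have [v [t [ht VE ->]]] := localiser_max k0 kk; have [_ iq _] := is_max_slope ht.
have m1 : mass (slope t) = 1.
  by apply: is_max_mass1 ht => x; exact/dom_K_integrable.
by split; [exact/slope_densityP|exact: max_worst_case ht VE m1].
Qed.

End worst_case_duality.

(** * Reduction of the theorem to an exhaustion and an everywhere finite profile *)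

Lemma exhaustion_exists d (T : measurableType d) (R : realType)
    (mu : {sigma_finite_measure set T -> \bar R}) (beta : T -> R -> \bar R) (X : T -> R) :
  convex_integrand beta -> measurable_fun setT X -> exists core, exhaustion mu beta X core.
Proof.
move=> hbeta hX.
have /sigma_finiteP[F [FT Fh Fm]] := sigma_finiteT mu.
exists (fun n r => [&& r \in F n, `|X r| <= n%:R, `|fine (beta r 1)| <= n%:R &
  `|dbeta beta r 1| <= n%:R]).
have mle (f : T -> R) n : measurable_fun setT f ->
    measurable_fun setT (fun r => `|f r| <= n%:R).
  by move=> mf; apply: measurable_fun_ler => //; exact: measurableT_comp.
have mcore n : measurable_fun setT (fun r => [&& r \in F n, `|X r| <= n%:R,
    `|fine (beta r 1)| <= n%:R & `|dbeta beta r 1| <= n%:R]).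
  apply: measurable_and.
    apply: (measurable_fun_bool true); rewrite setTI.
    rewrite (_ : _ @^-1` _ = F n); first by have [] := Fm n.
    by apply/seteqP; split => r; rewrite /preimage/= -[_ = true]/(is_true _) in_setE.
  apply: measurable_and; first exact: mle.
  apply: measurable_and; apply: mle; first exact: measurable_fine_beta.
  exact: measurable_dbeta.
split => //.
- move=> n; have [mF Ffin] := Fm n; apply: le_lt_trans Ffin; apply: le_measure; rewrite ?inE//.
    by have := mcore n measurableT [set true]; rewrite setTI; apply.
  by move=> r /= /and4P[]; rewrite in_setE.
- move=> m n r mn /and4P[h1 h2 h3 h4].
  have mn' : m%:R <= n%:R :> R by rewrite ler_nat.
  apply/and4P; split; try exact: le_trans mn'.
  by have := Fh _ _ mn; rewrite subsetEset => FF; move: h1; rewrite !in_setE; exact: FF.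
- move=> r; have : [set: T] r by [].
  rewrite FT => -[i _ Fi].
  have h : \forall n \near \oo, [&& r \in F n, `|X r| <= n%:R,
      `|fine (beta r 1)| <= n%:R & `|dbeta beta r 1| <= n%:R].
    near=> n; apply/and4P; split; try by near: n; exact: nbhs_infty_ger.
    rewrite in_setE; have in_ : (i <= n)%N by near: n; exact: nbhs_infty_ge.
    by have := Fh _ _ in_; rewrite subsetEset; apply.
  by have [n _ hn] := h; exists n; apply: hn => /=.
- by move=> n r /and4P[].
Unshelve. all: by end_near. Qed.

Unset Implicit Arguments.
Set Strict Implicit.

Local Open Scope ereal_scope.

Theorem theorem3 (d : measure_display) (T : measurableType d) (R : realType)
    (mu : {sigma_finite_measure set T -> \bar R})
    (beta : T -> R -> \bar R) (X p0 : T -> R)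
    (hbeta : convex_integrand beta)
    (hX : measurable_fun [set: T] X)
    (hp0 : is_density mu p0)
    (hb0 : integral_defined mu (fun r => (X r * p0 r)%:E))
    (hm : ess_inf mu (EFin \o X) < \int[mu]_r (X r * p0 r)%:E)
    (hM : \int[mu]_r (X r * p0 r)%:E < ess_sup mu (EFin \o X))
    (hH0 : H mu beta p0 = 0)
    (hH : forall p : T -> R, is_density mu p -> H mu beta p0 <= H mu beta p)
    (hkmax : 0 < k_max mu beta X) :
  (forall k : R, (0 < k)%R -> k%:E < k_max mu beta X ->
     (is_density mu (localiser mu beta X k) ->
      ~ (condition_D mu beta X /\ condition_C mu beta X k) ->
      worst_case_density mu beta X k (localiser mu beta X k))
     /\
     (condition_D mu beta X -> condition_C mu beta X k ->
      [/\ localiser mu beta X k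
            = localiser mu beta X (fine (k_cr mu beta X)) %[ae mu],
          localiser mu beta X (fine (k_cr mu beta X))
            = q_theta mu beta X (fine (theta_min mu beta X)) %[ae mu] &
          ~ exists p : T -> R, worst_case_density mu beta X k p]))
  /\
  ((forall t1 : R, dom_K mu beta X (t1, 0%R)) ->
   forall k : R, (0 < k)%R -> k%:E < k_max mu beta X ->
     is_density mu (localiser mu beta X k) /\
     (~ (condition_D mu beta X /\ condition_C mu beta X k) ->
      worst_case_density mu beta X k (localiser mu beta X k))).
Proof.
have [core hcore] := exhaustion_exists mu hbeta hX.
have [mp0 p00 p0m] := hp0.
have hH' p : is_density mu p -> 0 <= H mu beta p by move=> /hH; rewrite hH0.
have mXp0 : measurable_fun setT (fun r => X r * p0 r)%R by exact: measurable_funM.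
(* Strict inequalities on both sides, [hm] and [hM], exclude infinite values. *)
have b0fin : \int[mu]_r (X r * p0 r)%:E \is a fin_num.
  by rewrite fin_numElt (le_lt_trans (leNye _) hm) (lt_le_trans hM (leey _)).
have hb : has_integral mu (EFin \o (fun r => X r * p0 r)%R)
    (fine (\int[mu]_r (X r * p0 r)%:E))%:E.
  by split => //; rewrite fineK.
have [iX eX] := has_integral_fin mXp0 hb.
have Hfin : H mu beta p0 < +oo by rewrite hH0 ltry.
(* The default density is replaced by an a.e. equal representative of everywhere finite energy, with
   the same mass, expectation and energy. *)
have [p1 [hp1 _ m1 e1 HE]] := density_profile hbeta hX hH' hp0 Hfin iX.
apply: (localiser_theorem hbeta hX hp1 hcore m1 _ _ hH').
  by move: HE; rewrite hH0 => -[].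
by rewrite e1 eX fineK.
Qed.
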